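(* Let $(M,F)$ be a Finsler manifold admitting a concurrent $\pi$-vector field $\overline{\varphi}$ with associated $\pi$-form $\phi=i_{\overline{\varphi}}g$; put $\Phi=\phi(\overline{\eta})$ and $p^2=g(\overline\varphi,\overline\varphi)$. Let $\widehat F=\frac{F^2}{F-\Phi}$ on $\mathcal D=\{(x,y)\in TM : F(x,y)>\Phi(x,y)\}$ be a generalized $\phi$-Matsumoto metric (i.e. a conic pseudo-Finsler structure), with $F(1+2p^2)-3\Phi\ne0$ on $\mathcal D$, and set $$f_1=\frac{F(4\Phi-F)}{F(1+2p^2)-3\Phi},\qquad f_2=\frac{2F^3}{F(1+2p^2)-3\Phi}.$$ Then the Barthel connections $\widehat\Gamma$ of $\widehat F$ and $\Gamma$ of $F$ are related on $\mathcal D$ by $$\widehat\Gamma=\Gamma-f_1\,J-d_Jf_1\otimes\gamma\overline\eta+d_Jf_2\otimes\gamma\overline\varphi .$$ Consequently, the horizontal map $\widehat\beta$ of $\widehat F$ is, for every $\pi$-vector field $\overline W$, $$\widehat\beta\,\overline W=\beta\overline W-\frac12\left\{f_1\,\gamma\overline W+d_Jf_1(\beta\overline W)\,\gamma\overline\eta-d_Jf_2(\beta\overline W)\,\gamma\overline\varphi\right\}.$$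
   Context: Setting. $M$ is an $n$-dimensional paracompact smooth manifold, $\pi:TM\to M$ its tangent bundle, $\mathcal TM=TM\setminus\{0\}$ the slit tangent bundle. $\pi$-vector fields are smooth sections of the pullback of the bundle $TM\to M$ over $\mathcal TM$ (local basis $\overline{\partial}_i$); $\pi$-forms/tensors are the corresponding (dual) tensor sections. $\gamma$ is the natural injection (vertical lift) $\gamma(W^i\overline\partial_i)=W^i\partial_{y^i}$, $\rho(a^i\partial_{x^i}+b^i\partial_{y^i})=a^i\overline\partial_i$, $J=\gamma\circ\rho$, $\overline\eta(u)=(u,u)$ (i.e. $\overline\eta=y^i\overline\partial_i$), $\mathcal C=\gamma\overline\eta$, and $d_Jf=df\circ J$ for functions $f$. Finsler structure: $F:TM\to[0,\infty)$, $C^\infty$ on $\mathcal TM$, $C^0$ on $TM$, positively homogeneous of degree 1 in $y$, with $dd_JE$ of maximal rank, $E=\frac12F^2$. Metric tensor: $g(\rho W,\rho Z)=dd_JE(JW,Z)$ (it is positive definite). Geodesic spray $G$: the vector field with $JG=\mathcal C$, $[\mathcal C,G]=G$, $i_Gdd_JE=-dE$. Barthel connection $\Gamma=[J,G]$ (i.e. $\Gamma X=[JX,G]-J[X,G]$), projectors $h=\frac12(I+\Gamma)$, $v=\frac12(I-\Gamma)$, horizontal map $\beta=(\rho|_{\mathrm{Im}\,h})^{-1}$. Berwald connection $D^\circ$: $\gamma D^\circ_{hZ}\rho W=v[hZ,JW]$, $D^\circ_{\gamma\overline Z}\overline W=\rho[\gamma\overline Z,\beta\overline W]$. Cartan connection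 $\nabla$: determined by $2g(\nabla_{\gamma\overline X}\overline Y,\overline Z)=\gamma\overline X\cdot g(\overline Y,\overline Z)+g(\overline Y,\rho[\beta\overline Z,\gamma\overline X])+g(\overline Z,\rho[\gamma\overline X,\beta\overline Y])$ and $2g(\nabla_{\beta\overline X}\overline Y,\overline Z)=\beta\overline X\cdot g(\overline Y,\overline Z)+\beta\overline Y\cdot g(\overline Z,\overline X)-\beta\overline Z\cdot g(\overline X,\overline Y)-g(\overline X,\rho[\beta\overline Y,\beta\overline Z])+g(\overline Y,\rho[\beta\overline Z,\beta\overline X])+g(\overline Z,\rho[\beta\overline X,\beta\overline Y])$. Concurrent $\pi$-vector field: a non-vanishing $\pi$-vector field $\overline\varphi$ with $\nabla_{\beta\overline W}\overline\varphi=-\overline W=D^\circ_{\beta\overline W}\overline\varphi$ and $\nabla_{\gamma\overline W}\overline\varphi=0=D^\circ_{\gamma\overline W}\overline\varphi$ for all $\overline W$. Conic pseudo-Finsler structure on $M$: a smooth function to $[0,\infty)$ on a conic sub-bundle $\mathcal D\subset\mathcal TM$ (non-empty, open, invariant under scaling by positive reals, $\pi(\mathcal D)=M$, each fibre $\mathcal D_x$ connected), positively 1-homogeneous in $y$, whose form $dd_J(\frac12(\cdot)^2)$ has maximal rank. For the conic pseudo-Finsler structure $\widehat F$, the energy $\widehat E=\frac12\widehat F^2$, metric tensor $\widehat g$, geodesic spray $\widehat G$, Barthel connection $\widehat\Gamma$, projectors $\widehat h,\widehat v$, horizontal map $\widehat\beta$, Berwald connection $\widehat D^\circ$ and Cartan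 connection $\widehat\nabla$ are defined on $\mathcal D$ by the same formulas as the corresponding unhatted objects of $F$. *)

(* Defs.v *)
From HB Require Import structures.
From mathcomp Require Import all_boot all_order all_algebra.
From mathcomp Require Import all_classical all_reals all_analysis.
Set Implicit Arguments.
Unset Strict Implicit.
Unset Printing Implicit Defensive.
Import Order.TTheory GRing.Theory Num.Theory.
Import numFieldNormedType.Exports.
Local Open Scope classical_set_scope.
Local Open Scope ring_scope.

(* C^infty on a set A (always used with A open): all iterated directional
   derivatives exist on A and are (Frechet) differentiable there. *)
Definition iter_derive (R : realType) (V W : normedModType R) (vs : seq V)
    (f : V -> W) : V -> W :=
  foldr (fun v (g : V -> W) x => 'D_v g x) f vs.

Definition smooth_on (R : realType) (V W : normedModType R) (A : set V)
    (f : V -> W) : Prop :=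
  forall (vs : seq V) (x : V), A x -> differentiable (iter_derive vs f) x.

Definition paracompact (T : topologicalType) : Prop :=
  forall C : set (set T),
    (forall A, C A -> open A) -> \bigcup_(A in C) A = [set: T] ->
    exists C' : set (set T),
      [/\ (forall A, C' A -> open A),
          \bigcup_(A in C') A = [set: T],
          (forall A, C' A -> exists2 B, C B & A `<=` B) &
          (forall x : T, exists2 N, nbhs x N &
             finite_set [set A | C' A /\ A `&` N !=set0])].

(* An n-dimensional paracompact (Hausdorff) smooth manifold, given by a smooth
   atlas.  [ichart i] is the inverse of the chart [chart i]; it is only
   meaningful on the image of the chart, and [chart i] only on [chdom i]. *)
Record smoothManifold (R : realType) (n : nat) := SmoothManifold {
  mpoint :> topologicalType;
  mindex : Type;
  chdom : mindex -> set mpoint;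
  chart : mindex -> mpoint -> 'rV[R]_n;
  ichart : mindex -> 'rV[R]_n -> mpoint;
  chart_at : mpoint -> mindex;
  chart_atP : forall x, chdom (chart_at x) x;
  chdom_open : forall i, open (chdom i);
  image_open : forall i, open (chart i @` chdom i);
  chartK : forall i x, chdom i x -> ichart i (chart i x) = x;
  chart_continuous : forall i x, chdom i x -> {for x, continuous (chart i)};
  ichart_continuous : forall i a, (chart i @` chdom i) a ->
    {for a, continuous (ichart i)};
  trans_smooth : forall i j,
    smooth_on (chart i @` (chdom i `&` chdom j)) (chart j \o ichart i);
  mhausdorff : hausdorff_space mpoint;
  mparacompact : paracompact mpoint }.

Arguments chdom {R n s}.
Arguments chart {R n s}.
Arguments ichart {R n s}.
Arguments chart_at {R n s}.

Section TangentBundle.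
Context (R : realType) (n : nat) (M : smoothManifold R n).
Implicit Types (i j k : mindex M) (x : M).
Local Notation V := 'rV[R]_n.

Definition trans i j : V -> V := chart j \o ichart i.

(* A tangent vector at x: its components in all charts around x, related by
   the differentials of the transition maps.  Components in the other charts
   are set to 0, so that a tangent vector has a unique representation. *)
Record tangent (x : M) := Tangent {
  tvcomp : mindex M -> V;
  tvcomp_trans : forall i j, chdom i x -> chdom j x ->
    tvcomp j = 'D_(tvcomp i) (trans i j) (chart i x);
  tvcomp_out : forall i, ~ chdom i x -> tvcomp i = 0 }.

Definition TM := {x : M & tangent x}.
Definition tproj (u : TM) : M := projT1 u.

(* The tangent vector at x with components a in the chart i (if chdom i x). *)
Definition vec_comp i x (a : V) : mindex M -> V := fun j =>
  if `[< chdom i x /\ chdom j x >] then 'D_a (trans i j) (chart i x) else 0.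

Lemma derive_dir0 (U W : normedModType R) (f : U -> W) (x : U) :
  'D_0 f x = 0.
Proof.
rewrite /derive (_ : (fun _ => _) = fun=> 0) ?lim_cst//.
by apply/funext => h /=; rewrite scaler0 add0r subrr scaler0.
Qed.

Lemma trans_differentiable i j x : chdom i x -> chdom j x ->
  differentiable (trans i j) (chart i x).
Proof. by move=> xi xj; apply: (trans_smooth [::]); exists x. Qed.

Lemma vec_comp_trans i x (a : V) j k : chdom j x -> chdom k x ->
  vec_comp i x a k = 'D_(vec_comp i x a j) (trans j k) (chart j x).
Proof.
move=> xj xk; rewrite /vec_comp; case: asboolP => [[xi _]|Nxi]; last first.
  case: asboolP => [[xi _]|_]; last by rewrite derive_dir0.
  by case: Nxi.
rewrite asboolT//.
have tij : trans i j (chart i x) = chart j x by rewrite /trans /= chartK.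
have dij := trans_differentiable xi xj.
have djk : differentiable (trans j k) (trans i j (chart i x)).
  by rewrite tij; exact: trans_differentiable.
have ikE : \forall y \near chart i x,
    trans i k y = (trans j k \o trans i j) y.
  have xU : (chart i @` chdom i) (chart i x) by exists x.
  have : \forall y \near chart i x, chdom j (ichart i y).
    apply: (ichart_continuous xU); rewrite /= chartK//.
    by apply: open_nbhs_nbhs; split => //; exact: chdom_open.
  by apply: filterS => y yj; rewrite /trans /= chartK.
rewrite (near_eq_derive a ikE) deriveE; last exact: differentiable_comp.
by rewrite diff_comp//= -tij (deriveE _ djk) (deriveE _ dij).
Qed.

Lemma vec_comp_out i x (a : V) j : ~ chdom j x -> vec_comp i x a j = 0.
Proof. by move=> Nj; rewrite /vec_comp asboolF// => -[]. Qed.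

Definition vec i x (a : V) : TM :=
  existT _ x (Tangent (@vec_comp_trans i x a) (@vec_comp_out i x a)).

(* Coordinates (x^i, y^i) on TM, and their inverse. *)
Definition tcoord i (u : TM) : V * V := (chart i (tproj u), tvcomp (projT2 u) i).
Definition itcoord i (p : V * V) : TM := vec i (ichart i p.1) p.2.

Definition ttrans i j (p : V * V) : V * V :=
  (trans i j p.1, 'D_(p.2) (trans i j) p.1).

(* Tangent vectors to TM at u: components a^i d/dx^i + b^i d/dy^i. *)
Record ttangent (u : TM) := TTangent {
  ttcomp : mindex M -> V * V;
  ttcomp_trans : forall i j, chdom i (tproj u) -> chdom j (tproj u) ->
    ttcomp j = 'D_(ttcomp i) (ttrans i j) (tcoord i u);
  ttcomp_out : forall i, ~ chdom i (tproj u) -> ttcomp i = 0 }.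

(* pi-vector fields and vector fields on TM are total functions; they are only
   used (and only required to be smooth) on an open subset of TM. *)
Definition pifield := forall u : TM, tangent (tproj u).
Definition vfield := forall u : TM, ttangent u.

Definition etabar : pifield := fun u => projT2 u.

Definition slit : set TM := [set u | tvcomp (projT2 u) <> fun=> 0].

(* Local expressions in the chart of TM induced by i. *)
Definition loc (D : set TM) i : set (V * V) :=
  [set p | (chart i @` chdom i) p.1 /\ D (itcoord i p)].
Definition floc (f : TM -> R) i : V * V -> R := fun p => f (itcoord i p).
Definition piloc (W : pifield) i : V * V -> V :=
  fun p => tvcomp (W (itcoord i p)) i.
Definition vloc (X : vfield) i : V * V -> V * V :=
  fun p => ttcomp (X (itcoord i p)) i.

End TangentBundle.

Arguments slit {R n M}.
Arguments etabar {R n M}.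

(* Calculus in one chart of TM, i.e. on V * V with coordinates (x^i, y^i).
   A vector field is its pair of component functions. *)
Section ChartCalculus.
Context (R : realType) (n : nat).
Local Notation V := 'rV[R]_n.
Implicit Types (p xi zeta : V * V) (O : set (V * V)) (E f : V * V -> R)
  (G X Y Z : V * V -> V * V).

Definition bracket X Y : V * V -> V * V :=
  fun p => 'D_(X p) Y p - 'D_(Y p) X p.

Definition gamma (w : V) : V * V := (0, w).
Definition rho xi : V := xi.1.
Definition vJ xi : V * V := gamma (rho xi).
Definition liouville p : V * V := gamma p.2.

Definition dJ f p xi : R := 'D_(vJ xi) f p.

(* Exterior derivative of a 1-form om, where om p xi is om_p(xi). *)
Definition ext_d (om : V * V -> V * V -> R) p xi zeta : R :=
  'D_xi (om ^~ zeta) p - 'D_zeta (om ^~ xi) p.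

Definition ddJ E : V * V -> V * V -> V * V -> R := ext_d (dJ E).

(* (w, 0) is a vector with rho (w, 0) = w: this is g(rho W, rho Z) =
   dd_J E(JW, Z). *)
Definition metric E p (w z : V) : R := ddJ E p (vJ (w, 0)) (z, 0).

Definition frame (k : 'I_(n + n)) : V * V :=
  (lsubmx (delta_mx 0 k : 'rV[R]_(n + n)), rsubmx (delta_mx 0 k : 'rV[R]_(n + n))).

Definition max_rank (b : V * V -> V * V -> R) : Prop :=
  \rank (\matrix_(k, l) b (frame k) (frame l)) = (n + n)%N.

(* Gamma = [J, G], h = (I + Gamma) / 2, v = (I - Gamma) / 2. *)
Definition barthel G X : V * V -> V * V := fun p =>
  bracket (vJ \o X) G p - vJ (bracket X G p).
Definition hproj G X : V * V -> V * V := fun p =>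
  2^-1 *: (X p + barthel G X p).
Definition vproj G X : V * V -> V * V := fun p =>
  2^-1 *: (X p - barthel G X p).

Definition hspace G p : set (V * V) :=
  [set hproj G X p | X in [set X | exists2 A, open_nbhs p A & smooth_on A X]].

(* The inverse of rho restricted to the horizontal space Im h. *)
Definition beta G (W : V * V -> V) : V * V -> V * V := fun p =>
  xget 0 [set xi | hspace G p xi /\ rho xi = W p].

Implicit Types (U W T : V * V -> V).

(* D° being the Berwald connection and nabla the Cartan connection,
   the next predicates say that T is, on O, respectively
   D°_{beta U} W, D°_{gamma U} W, nabla_{gamma U} W and nabla_{beta U} W.
   The first one is gamma (D°_{hZ} (rho Y)) = v [hZ, JY] for hZ = beta U and
   rho Y = W. *)
Definition berwald_h O G U W T : Prop := forall p, O p ->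
  gamma (T p) = vproj G (bracket (beta G U) (gamma \o W)) p.

Definition berwald_v O G U W T : Prop := forall p, O p ->
  T p = rho (bracket (gamma \o U) (beta G W) p).

Definition cartan_v O E G U W T : Prop :=
  forall Z : V * V -> V, smooth_on O Z -> forall p, O p ->
  2 * metric E p (T p) (Z p) =
    'D_(gamma (U p)) (fun q => metric E q (W q) (Z q)) p
    + metric E p (W p) (rho (bracket (beta G Z) (gamma \o U) p))
    + metric E p (Z p) (rho (bracket (gamma \o U) (beta G W) p)).

Definition cartan_h O E G U W T : Prop :=
  forall Z : V * V -> V, smooth_on O Z -> forall p, O p ->
  2 * metric E p (T p) (Z p) =
    'D_(beta G U p) (fun q => metric E q (W q) (Z q)) p
    + 'D_(beta G W p) (fun q => metric E q (Z q) (U q)) p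
    - 'D_(beta G Z p) (fun q => metric E q (U q) (W q)) p
    - metric E p (U p) (rho (bracket (beta G W) (beta G Z) p))
    + metric E p (W p) (rho (bracket (beta G Z) (beta G U) p))
    + metric E p (Z p) (rho (bracket (beta G U) (beta G W) p)).

End ChartCalculus.

Section Finsler.
Context (R : realType) (n : nat) (M : smoothManifold R n).
Local Notation V := 'rV[R]_n.
Implicit Types (F : TM M -> R) (D : set (TM M)) (G : vfield M) (phi : pifield M).

Definition energy F : TM M -> R := fun u => F u ^+ 2 / 2.

(* The metric tensor of F at u, computed in a chart around u (the value does
   not depend on the chart). *)
Definition metric_at F (u : TM M) (w z : tangent (tproj u)) : R :=
  let i := chart_at (tproj u) in
  metric (floc (energy F) i) (tcoord i u) (tvcomp w i) (tvcomp z i).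

Definition pos_homogeneous1 D F : Prop := forall i p (c : R),
  loc D i p -> 0 < c -> floc F i (p.1, c *: p.2) = c * floc F i p.

Definition finsler F : Prop :=
  [/\ (forall u, 0 <= F u),
      (forall i, smooth_on (loc slit i) (floc F i)),
      (forall i p, loc setT i p -> {for p, continuous (floc F i)}),
      pos_homogeneous1 setT F &
      (forall i p, loc slit i p -> max_rank (ddJ (floc (energy F) i) p))].

Record conic_subbundle D : Prop := ConicSubbundle {
  conic_slit : D `<=` slit;
  conic_nonempty : D !=set0;
  conic_open : forall i, open (loc D i);
  conic_scale : forall i p (c : R),
    loc D i p -> 0 < c -> loc D i (p.1, c *: p.2);
  conic_proj : [set tproj u | u in D] = setT;
  conic_connected : forall i x, chdom i x ->
    connected [set y : V | D (vec i x y)] }.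

Definition conic_pseudo_finsler D F : Prop :=
  [/\ conic_subbundle D,
      (forall u, D u -> 0 <= F u),
      (forall i, smooth_on (loc D i) (floc F i)),
      pos_homogeneous1 D F &
      (forall i p, loc D i p -> max_rank (ddJ (floc (energy F) i) p))].

(* G is, on D, the geodesic spray of the (conic pseudo-)Finsler structure F;
   the last condition determines it. *)
Definition geodesic_spray D F G : Prop := forall i,
  [/\ smooth_on (loc D i) (vloc G i),
      (forall p, loc D i p -> vJ (vloc G i p) = liouville p),
      (forall p, loc D i p ->
         bracket (@liouville R n) (vloc G i) p = vloc G i p) &
      (forall p zeta, loc D i p ->
         ddJ (floc (energy F) i) p (vloc G i p) zeta =
         - 'D_zeta (floc (energy F) i) p)].

(* Since the connections are local operators, W ranges over the smooth
   pi-vector fields above each chart domain, given by their components. *)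
Definition concurrent F G phi : Prop :=
  [/\ (forall i, smooth_on (loc slit i) (piloc phi i)),
      (forall u, slit u -> tvcomp (phi u) <> fun=> 0) &
      (forall i (W : V * V -> V), smooth_on (loc slit i) W ->
         let O := loc slit i in
         let E := floc (energy F) i in
         [/\ cartan_h O E (vloc G i) W (piloc phi i) (fun p => - W p),
             berwald_h O (vloc G i) W (piloc phi i) (fun p => - W p),
             cartan_v O E (vloc G i) W (piloc phi i) (fun=> 0) &
             berwald_v O (vloc G i) W (piloc phi i) (fun=> 0)])].

End Finsler.

(* Main.v *)
Require Import Defs.
From HB Require Import structures.
From mathcomp Require Import all_boot all_order all_algebra.
From mathcomp Require Import all_classical all_reals all_analysis.
Set Implicit Arguments.
Unset Strict Implicit.
Unset Printing Implicit Defensive.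
Import Order.TTheory GRing.Theory Num.Theory.
Import numFieldNormedType.Exports.
Local Open Scope classical_set_scope.
Local Open Scope ring_scope.
From mathcomp Require Import ring lra.

(** In a chart the spray is G = (y, g) and the horizontal lift of a is
    (a, D_{(0,a)} g / 2), so Gamma (a, b) = (a, D_{(0,a)} g - b), and both
    claims reduce to the identity Ghat = G - f1 C + f2 gamma(phi).  By the
    nondegeneracy of dd_J Ehat, that amounts to checking that the right-hand
    side satisfies the Euler-Lagrange equations of Ehat.

    The energy is horizontally constant, which with D°_{beta a} phi = - a gives
    D_{beta a} Phi = - D_{(0,a)} E.  Hence D_G Phi = - F^2, and Phi satisfies
    the Euler-Lagrange equations D_G D_{(0,a)} Phi = D_{(a,0)} Phi (the form
    d_J Phi is closed), as F does.  Since nabla_{gamma u} phi = 0, Phi is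
    moreover affine along the fibres.  As Ehat = F^4 / (2 (F - Phi)^2) is a
    function of F and Phi, its Euler-Lagrange expression is a combination of
    D_{(0,a)} F and D_{(0,a)} Phi, and f1, f2 are the solution of the resulting
    linear system. *)

(** * Directional derivatives *)

Section DirectionalDerivatives.
Context (R : realType).
Implicit Types V W : normedModType R.

Lemma deriveD_dir V W (f : V -> W) p u v : differentiable f p ->
  'D_(u + v) f p = 'D_u f p + 'D_v f p.
Proof. by move=> df; rewrite !deriveE// linearD. Qed.

Lemma deriveZ_dir V W (f : V -> W) p (c : R) u : differentiable f p ->
  'D_(c *: u) f p = c *: 'D_u f p.
Proof. by move=> df; rewrite !deriveE// linearZ. Qed.

Lemma derive_sum_dir V W (f : V -> W) p n (c : 'I_n -> R) (b : 'I_n -> V) :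
  differentiable f p ->
  'D_(\sum_i c i *: b i) f p = \sum_i c i *: 'D_(b i) f p.
Proof.
move=> df; rewrite deriveE// linear_sum; apply: eq_bigr => i _.
by rewrite linearZ deriveE.
Qed.

Lemma near_eq_differentiable V W (f g : V -> W) p :
  (\forall q \near p, f q = g q) -> differentiable f p -> differentiable g p.
Proof.
move=> fg df; have [dc /eqaddoP dE] := (diff_locallyP _ _).1 df.
have fgp : f p = g p by exact: nbhs_singleton fg.
have gE : g \o shift p = cst (g p) + 'd f p +o_ 0 id.
  have fg0 : \forall x \near (0 : V), f (x + p) = g (x + p).
    by move: fg; rewrite (near_shift 0 p) subr0.
  apply/eqaddoP => e e0; have := dE e e0; apply: filterS2 fg0.
  by move=> x /= fgx; rewrite !fctE /= -fgp -fgx.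
by apply/diff_locallyP; rewrite (diff_unique dc gE).
Qed.

(** Reduces a directional derivative to an ordinary one along a line, as needed for the mean value
    theorem and for Euler's theorem on homogeneous functions. *)
Lemma is_derive_line V W (f : V -> W) v a (s : R) :
  differentiable f (s *: v + a) ->
  is_derive s 1 (fun s : R => f (s *: v + a)) ('D_v f (s *: v + a)).
Proof.
move=> df; have E : (fun h : R => h^-1 *:
    (((fun s : R => f (s *: v + a)) \o shift s) (h *: 1) - f (s *: v + a))) =
  (fun h : R => h^-1 *: ((f \o shift (s *: v + a)) (h *: v) - f (s *: v + a))).
  apply/funext => h /=; congr (_ *: (f _ - _)).
  by rewrite [h *: 1]mulr1 scalerDl addrA.
by split; [rewrite /derivable E; exact: diff_derivable|rewrite /derive E].
Qed.

(* Mean value theorem applied to s |-> f (p + s v + t w) - f (p + s v); as only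
   the differentiability of D_v f at p is used, no continuity of the mixed
   derivatives is needed in [derive_swap]. *)
Lemma second_difference V (f : V -> R) (O : set V) p v w (e : R) :
  open O -> O p -> (forall q, O q -> differentiable f q) ->
  differentiable ('D_v f) p -> 0 < e ->
  exists2 d : R, 0 < d & forall t, 0 < t < d ->
    `|f (t *: v + (t *: w + p)) - f (t *: v + p) - f (t *: w + p) + f p
      - t ^+ 2 * 'D_w ('D_v f) p| <= e * t ^+ 2.
Proof.
move=> oO Op df dDf e0.
have [_ /eqaddoP dE] := (diff_locallyP _ _).1 dDf.
(* [t * N] bounds the norm of s v + b w for s, b in [0, t]; the summand 1 keeps [N] positive when v
   = w = 0. *)
set N := `|v| + `|w| + 1.
have N0 : 0 < N by rewrite ltr_wpDl// addr_ge0.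
(* With this slope the linearization error of ['D_v f] is at most e / 2 * t; two such errors, times
   the factor t of the mean value theorem, make e t^2. *)
have e20 : 0 < e / (2 * N) by rewrite divr_gt0// mulr_gt0.
have {dE} := dE _ e20.
move=> /nbhs_ballP[d1 /= d10 D1].
have : nbhs p O by exact: open_nbhs_nbhs.
move=> /nbhs_ballP[d2 /= d20 D2].
have Dlt : 0 < Num.min d1 d2 by rewrite lt_min d10.
exists (Num.min d1 d2 / N); first by rewrite divr_gt0.
move=> t /andP[t0 td].
have tN : t * N < Num.min d1 d2 by rewrite -ltr_pdivlMr.
have small s b : 0 <= s <= t -> 0 <= b <= t -> `|s *: v + b *: w| <= t * N.
  move=> /andP[s0 st] /andP[b0 bt].
  rewrite (le_trans (ler_normD _ _))// !normrZ !ger0_norm//.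
  rewrite /N !mulrDr -[leLHS]addr0 !lerD ?ler_wpM2r//.
  by rewrite mulr1 ltW.
have inO s b : 0 <= s <= t -> 0 <= b <= t -> O (s *: v + (b *: w + p)).
  move=> sI bI; apply: D2; rewrite -ball_normE /= opprD addrA.
  rewrite (_ : p - _ - _ = - (s *: v + b *: w)).
    by rewrite normrN (le_lt_trans (small _ _ sI bI))// (lt_le_trans tN)// ge_min lexx orbT.
  by rewrite !opprD !addrA addrC !addrA [- p + p]addrC subrr add0r.
have lin s b : 0 <= s <= t -> 0 <= b <= t ->
    `|'D_v f (s *: v + (b *: w + p)) - 'D_v f p
       - (s *: 'd ('D_v f) p v + b *: 'd ('D_v f) p w)| <= e / 2 * t.
  move=> sI bI; have : ball 0 d1 (s *: v + b *: w).
    rewrite -ball_normE /= sub0r normrN (le_lt_trans (small _ _ sI bI))//.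
    by rewrite (lt_le_trans tN)// ge_min lexx.
  move=> /D1; rewrite !fctE /=.
  have -> : 'd ('D_v f) p (s *: v + b *: w)
      = s *: 'd ('D_v f) p v + b *: 'd ('D_v f) p w by rewrite linearD !linearZ.
  rewrite !opprD !addrA => H; apply: (le_trans H).
  rewrite -ler_pdivlMl// (le_trans (small _ _ sI bI))//.
  by rewrite [leRHS](_ : _ = t * N)//; field; rewrite ?gt_eqF.
have tI : 0 <= t <= t by rewrite lexx ltW.
have zI : 0 <= (0 : R) <= t by rewrite lexx ltW.
pose psi (s : R) := f (s *: v + (t *: w + p)) - f (s *: v + p).
pose dpsi (s : R) := 'D_v f (s *: v + (t *: w + p)) - 'D_v f (s *: v + p).
have inO0 s : 0 <= s <= t -> O (s *: v + p).
  by move=> sI; have := inO s 0 sI zI; rewrite scale0r add0r.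
have dpsiP s : 0 <= s <= t -> is_derive s 1 psi (dpsi s).
  move=> sI; apply: is_deriveB; apply: is_derive_line; apply: df.
    exact: inO.
  exact: inO0.
have [||c cI] := @MVT R psi dpsi 0 t t0.
- by move=> s; rewrite in_itv /= => /andP[s0 st]; apply: dpsiP; rewrite !ltW.
- apply: derivable_within_continuous => s; rewrite in_itv /= => sI.
  by have [] := dpsiP s sI.
have {}cI : 0 <= c <= t by move: cI; rewrite in_itv /= => /andP[? ?]; rewrite !ltW.
rewrite subr0 /psi !scale0r !add0r => psiE.
rewrite (_ : _ + f p = f (t *: v + (t *: w + p)) - f (t *: v + p) - (f (t *: w + p) - f p)); last by ring.
rewrite psiE /dpsi (deriveE _ dDf).
have l1 := lin c t cI tI; have := lin c 0 cI zI.
rewrite !scale0r add0r addr0 => l2.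
set X := 'D_v f (c *: v + (t *: w + p)) in l1 *.
set Y := 'D_v f (c *: v + p) in l2 *.
set Z := 'D_v f p in l1 l2 *.
set A := _ *: _ in l1 l2; set B := 'd _ p w in l1 *.
have tB : t *: B = t * B by [].
rewrite tB in l1.
(* [A], which is c times the second derivative along v, occurs in the linearizations at both points
   and cancels; only the contribution of the increment t w remains. *)
rewrite (_ : (X - Y) * t - t ^+ 2 * B =
  t * ((X - Z - (A + t * B)) - (Y - Z - A))); last by ring.
rewrite normrM (gtr0_norm t0) [e * _](_ : _ = t * (e / 2 * t + e / 2 * t)); last by field.
by rewrite ler_pM2l// (le_trans (ler_normB _ _))// lerD.
Qed.

(** The second difference along t v and t w is symmetric in v and w, so, divided by t^2, it lies
    within e / 2 of both mixed derivatives for small t. *)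
Lemma derive_swap V (f : V -> R) (O : set V) p v w :
  open O -> O p -> (forall q, O q -> differentiable f q) ->
  differentiable ('D_v f) p -> differentiable ('D_w f) p ->
  'D_w ('D_v f) p = 'D_v ('D_w f) p.
Proof.
move=> oO Op df dv dw; apply/eqP; rewrite -subr_eq0 -normr_le0.
apply/ler_addgt0Pl => e e0; rewrite addr0.
have e20 : 0 < e / 2 by rewrite divr_gt0.
have [d1 d10 D1] := second_difference w oO Op df dv e20.
have [d2 d20 D2] := second_difference v oO Op df dw e20.
pose t := Num.min d1 d2 / 2.
have m0 : 0 < Num.min d1 d2 by rewrite lt_min d10.
have t0 : 0 < t by rewrite divr_gt0.
have tm : t < Num.min d1 d2 by rewrite /t; lra.
have [td1 td2] : t < d1 /\ t < d2 by move: tm; rewrite lt_min => /andP.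
have := D1 t; rewrite t0 td1 => /(_ isT) {}D1.
have := D2 t; rewrite t0 td2 => /(_ isT); rewrite !addrA [t *: w + t *: v]addrC -!addrA.
have t20 : 0 < t ^+ 2 by rewrite exprn_gt0.
move=> {}D2; rewrite -(ler_pM2l t20) -{1}(gtr0_norm t20) -normrM.
set a := 'D_w _ p in D1 *; set b := 'D_v _ p in D2 *.
move: D1 D2; rewrite !addrA; set X := f _; set Y := f _; set Z := f _; set T := f _.
move=> D1 D2.
rewrite (_ : t ^+ 2 * (a - b) = (X - Z - Y + T - t ^+ 2 * b) - (X - Y - Z + T - t ^+ 2 * a)); last by ring.
rewrite (le_trans (ler_normB _ _))//.
have -> : t ^+ 2 * e = e / 2 * t ^+ 2 + e / 2 * t ^+ 2 by field.
exact: lerD D2 D1.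
Qed.
End DirectionalDerivatives.

(** * Composition with continuous linear maps *)

Section LinearPostcomposition.
Context (R : realType) (U W X : normedModType R) (L : W -> X).
Hypotheses (lL : linear L) (cL : continuous L).

Lemma linear_fun_differentiable p : differentiable L p.
Proof.
pose L' : {linear W -> X} := HB.pack L (GRing.isLinear.Build R W X _ L lL).
exact: (@linear_differentiable _ _ _ L').
Qed.

Lemma linear_comp_differentiable (f : U -> W) p :
  differentiable f p -> differentiable (fun q => L (f q)) p.
Proof.
by move=> df; apply: (differentiable_comp df); exact: linear_fun_differentiable.
Qed.

Lemma derive_linear_comp (f : U -> W) p v :
  differentiable f p -> 'D_v (fun q => L (f q)) p = L ('D_v f p).
Proof.
move=> df; rewrite deriveE; last exact: linear_comp_differentiable.
pose L' : {linear W -> X} := HB.pack L (GRing.isLinear.Build R W X _ L lL).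
rewrite (diff_comp df (linear_fun_differentiable _)) /= (deriveE _ df).
by rewrite -[X in 'd X _ _ = _]/(L' : _ -> _) diff_lin.
Qed.
End LinearPostcomposition.

(** * Derivatives along a variable direction *)

Section VariableDirection.
Context (R : realType) (n : nat).
Local Notation V := 'rV[R]_n.
Implicit Types (f : V * V -> R) (w : V * V -> V * V) (p q x : V * V).

(** Coordinates with respect to [frame], indexed in the same way as the matrix of [max_rank]. *)
Definition fcoord (k : 'I_(n + n)) (q : V * V) : R := row_mx q.1 q.2 0 k.

Lemma fcoord_linear k : linear (fcoord k).
Proof.
move=> a u v; rewrite /fcoord !mxE; case: fintype.splitP => j _;
by rewrite !mxE.
Qed.

Lemma pfst_continuous : continuous (@fst V V).
Proof. by move=> p; exact: cvg_fst. Qed.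

Lemma psnd_continuous : continuous (@snd V V).
Proof. by move=> p; exact: cvg_snd. Qed.

Lemma pfst_linear : linear (@fst V V). Proof. by []. Qed.
Lemma psnd_linear : linear (@snd V V). Proof. by []. Qed.

Lemma fcoord_continuous k : continuous (fcoord k).
Proof.
have [j kE|j kE] := fintype.splitP k => p.
  rewrite (_ : fcoord k = (fun M : V => M 0 j) \o fst).
    apply: continuous_comp; first exact: pfst_continuous.
    exact: coord_continuous.
  apply/funext => q; rewrite /fcoord /=.
  have -> : k = lshift n j by exact: val_inj.
  by rewrite row_mxEl.
rewrite (_ : fcoord k = (fun M : V => M 0 j) \o snd).
  apply: continuous_comp; first exact: psnd_continuous.
  exact: coord_continuous.
apply/funext => q; rewrite /fcoord /=.
have -> : k = rshift n j by exact: val_inj.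
by rewrite row_mxEr.
Qed.

Lemma fcoord_frame q : q = \sum_k fcoord k q *: frame R k.
Proof.
have E : row_mx q.1 q.2 = \sum_k fcoord k q *: (delta_mx 0 k : 'rV[R]_(n + n)).
  exact: row_sum_delta.
rewrite [LHS]surjective_pairing [RHS]surjective_pairing; congr pair.
  rewrite (big_morph fst (id1 := 0) (op1 := +%R))// -[LHS](row_mxKl q.1 q.2) E.
  by rewrite linear_sum; apply: eq_bigr => k _; rewrite linearZ.
rewrite (big_morph snd (id1 := 0) (op1 := +%R))// -[LHS](row_mxKr q.1 q.2) E.
by rewrite linear_sum; apply: eq_bigr => k _; rewrite linearZ.
Qed.

Section OnePoint.
Variables (f : V * V -> R) (w : V * V -> V * V) (O : set (V * V)) (p : V * V).
Hypotheses (oO : open O) (Op : O p).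
Hypothesis df : forall q, O q -> differentiable f q.
Hypothesis ddf : forall u, differentiable ('D_u f) p.
Hypothesis dw : differentiable w p.

Let dirE w' : \forall q \near p, 'D_(w' q) f q =
  (\sum_k (fun q => fcoord k (w' q)) * 'D_(frame R k) f) q.
Proof.
have : nbhs p O by exact: open_nbhs_nbhs.
apply: filterS => q Oq; rewrite {1}(fcoord_frame (w' q)).
by rewrite derive_sum_dir ?fct_sumE//; exact: df.
Qed.

Let dcoord k : differentiable (fun q => fcoord k (w q)) p.
Proof.
apply: linear_comp_differentiable => //.
  exact: fcoord_linear.
exact: fcoord_continuous.
Qed.

(** Expanding w in the constant frame turns the derivative along w into a finite sum of products;
    the Leibniz rule then separates the derivative of f from that of the direction. *)
Lemma derive_dir xi : 'D_xi (fun q => 'D_(w q) f q) p =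
  'D_xi ('D_(w p) f) p + 'D_('D_xi w p) f p.
Proof.
have cD k : derivable (fun _ : V * V => fcoord k (w p) : R) p xi.
  exact/diff_derivable/differentiable_cst.
have wD k : derivable (fun q => fcoord k (w q)) p xi by exact: diff_derivable.
have fD k : derivable ('D_(frame R k) f) p xi by exact: diff_derivable.
transitivity ('D_xi (\sum_k (fun q => fcoord k (w q)) * 'D_(frame R k) f) p).
  exact: near_eq_derive (dirE w).
have -> : 'D_xi ('D_(w p) f) p
    = 'D_xi (\sum_k (fun q => fcoord k (w p)) * 'D_(frame R k) f) p.
  exact: near_eq_derive (dirE (fun=> w p)).
rewrite derive_sum => [|k]; last exact: derivableM.
rewrite derive_sum => [|k]; last exact: derivableM.
rewrite (fcoord_frame ('D_xi w p)) derive_sum_dir; last exact: df.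
rewrite -big_split; apply: eq_bigr => k _ /=.
rewrite deriveM// deriveM// derive_cst scaler0 addr0; congr (_ + _).
rewrite (derive_linear_comp (@fcoord_linear k) (@fcoord_continuous k))//.
exact: mulrC.
Qed.
End OnePoint.
End VariableDirection.

(** * Functions with finitely many derivatives *)

Fixpoint ndiff (R : realType) (V W : normedModType R) (k : nat) (O : set V)
    (f : V -> W) : Prop :=
  if k is k'.+1 then
    (forall p, O p -> differentiable f p) /\ forall v, ndiff k' O ('D_v f)
  else True.

Section Ndiff.
Context (R : realType).
Implicit Types V W : normedModType R.

(** Passing to a fixed order of differentiability lets closure under sums, products and variable
    directions be proved by induction on the order. *)
Lemma smooth_on_ndiff V W k (O : set V) (f : V -> W) :
  smooth_on O f -> ndiff k O f.
Proof.
elim: k f => //= k IH f sf; split=> [p|v]; first exact: (sf [::]).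
(* In [iter_derive] the direction applied first is the last entry of the list. *)
apply: IH => vs p Op; have := sf (rcons vs v) p Op.
by rewrite /iter_derive foldr_rcons.
Qed.

Lemma smooth_on_cst V W (O : set V) (c : W) : smooth_on O (fun _ => c).
Proof.
move=> vs p _; have [d ->] : exists d, iter_derive vs (fun _ : V => c) = cst d.
  elim: vs => [|v vs [d IH]]; first by exists c.
  by exists 0; apply/funext => q; rewrite /= IH derive_cst.
exact: differentiable_cst.
Qed.

Lemma ndiffS V W k (O : set V) (f : V -> W) : ndiff k.+1 O f -> ndiff k O f.
Proof.
elim: k f => // k IH f [df Df]; split=> // v.
exact/IH/Df.
Qed.

Lemma ndiffW V W k m (O : set V) (f : V -> W) :
  (k <= m)%N -> ndiff m O f -> ndiff k O f.
Proof.
move=> /subnK <-; elim: (m - k)%N => // j IH; rewrite addSn => /ndiffS.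
exact: IH.
Qed.

Lemma ndiff_sub V W k (O O' : set V) (f : V -> W) :
  O' `<=` O -> ndiff k O f -> ndiff k O' f.
Proof.
move=> OO; elim: k f => // k IH f [df Df]; split=> [p /OO|v]; first exact: df.
exact/IH/Df.
Qed.

Lemma derive_comb3 V (f : V -> R) p (a b : R) u v w z : differentiable f p ->
  'D_(u + (a *: v + (b *: w + z))) f p =
  'D_u f p + (a * 'D_v f p + b * 'D_w f p) + 'D_z f p.
Proof. by move=> df; rewrite !deriveD_dir// !deriveZ_dir// !addrA. Qed.

Lemma diff_is_derive V W (f : V -> W) p v :
  differentiable f p -> is_derive p v f ('D_v f p).
Proof. by move=> df; exact/derivableP/diff_derivable. Qed.

Lemma derive_eq_on V W (O : set V) (f g : V -> W) p v : open O -> O p ->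
  (forall q, O q -> f q = g q) -> 'D_v f p = 'D_v g p.
Proof.
move=> oO Op fg; apply: near_eq_derive.
have : nbhs p O by exact: open_nbhs_nbhs.
by apply: filterS => q /fg.
Qed.

Lemma differentiable_eq_on V W (O : set V) (f g : V -> W) p : open O -> O p ->
  (forall q, O q -> f q = g q) -> differentiable f p -> differentiable g p.
Proof.
move=> oO Op fg; apply: near_eq_differentiable.
have : nbhs p O by exact: open_nbhs_nbhs.
by apply: filterS => q /fg.
Qed.

Lemma ndiff_eq V W k (O : set V) (f g : V -> W) : open O ->
  (forall q, O q -> f q = g q) -> ndiff k O f -> ndiff k O g.
Proof.
move=> oO; elim: k f g => // k IH f g fg [df Df]; split=> [p Op|v].
  exact: (differentiable_eq_on oO Op fg (df p Op)).
by apply: IH (Df v) => q Oq; exact: derive_eq_on fg.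
Qed.

Lemma ndiff_cst V W k (O : set V) (c : W) : ndiff k O (fun _ : V => c).
Proof. by apply: smooth_on_ndiff; exact: smooth_on_cst. Qed.

Lemma ndiffD V W k (O : set V) (f g : V -> W) : open O ->
  ndiff k O f -> ndiff k O g -> ndiff k O (fun q => f q + g q).
Proof.
move=> oO; elim: k f g => // k IH f g [df Df] [dg Dg]; split=> [p Op|v].
  exact: (differentiableD (df p Op) (dg p Op)).
apply: ndiff_eq (IH _ _ (Df v) (Dg v)) => // q Oq.
by rewrite -deriveD//; apply: diff_derivable; [exact: df|exact: dg].
Qed.

Lemma ndiffM V k (O : set V) (f g : V -> R) : open O ->
  ndiff k O f -> ndiff k O g -> ndiff k O (fun q => f q * g q).
Proof.
move=> oO; elim: k f g => // k IH f g hf hg.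
have [[df Df] [dg Dg]] := (hf, hg); split=> [p Op|v].
  exact: (differentiableM (df p Op) (dg p Op)).
apply: ndiff_eq (ndiffD oO (IH _ _ (ndiffS hf) (Dg v)) (IH _ _ (ndiffS hg) (Df v))).
  by [].
move=> q Oq.
by rewrite deriveM//; apply: diff_derivable; [exact: df|exact: dg].
Qed.

Lemma ndiff_sum V k m (O : set V) (f : 'I_m -> V -> R) : open O ->
  (forall i, ndiff k O (f i)) -> ndiff k O (fun q => \sum_i f i q).
Proof.
move=> oO; elim: m f => [|m IH] f hf.
  by apply: ndiff_eq (ndiff_cst k O 0) => // q _; rewrite big_ord0.
apply: ndiff_eq (ndiffD oO (IH (fun i => f (widen_ord (leqnSn m) i)) _)
  (hf ord_max)) => // q _.
by rewrite big_ord_recr.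
Qed.

Lemma ndiff_linear V W (X : normedModType R) (L : W -> X) k (O : set V) (f : V -> W) :
  linear L -> continuous L -> open O ->
  ndiff k O f -> ndiff k O (fun q => L (f q)).
Proof.
move=> lL cL oO; elim: k f => // k IH f [df Df]; split=> [p Op|v].
  by apply: linear_comp_differentiable => //; exact: df.
apply: ndiff_eq (IH _ (Df v)) => // q Oq.
by rewrite (derive_linear_comp lL cL)//; exact: df.
Qed.

Lemma derive_swap_ndiff V (O : set V) (f : V -> R) p v w : open O -> O p ->
  ndiff 2 O f -> 'D_w ('D_v f) p = 'D_v ('D_w f) p.
Proof.
by move=> oO Op [df Df]; apply: (derive_swap oO Op df);
  [apply: (Df v).1|apply: (Df w).1].
Qed.
End Ndiff.

Section NdiffChart.
Context (R : realType) (n : nat).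
Local Notation V := 'rV[R]_n.
Variables (O : set (V * V)).
Hypothesis oO : open O.

(** By the frame expansion, f loses one order and the direction field none. *)
Lemma ndiff_dir k (f : V * V -> R) (w : V * V -> V * V) :
  ndiff k.+1 O f -> ndiff k O w -> ndiff k O (fun q => 'D_(w q) f q).
Proof.
move=> [df Df] hw.
apply: (@ndiff_eq _ _ _ _ _
   (fun q => \sum_k (fcoord k (w q) * 'D_(frame R k) f q))) => //.
  by move=> q Oq; rewrite {2}(fcoord_frame (w q)) derive_sum_dir//; exact: df.
apply: ndiff_sum => // i; apply: ndiffM => //; last exact: Df.
by apply: ndiff_linear => //; [exact: fcoord_linear|exact: fcoord_continuous].
Qed.

Lemma derive_dir_ndiff (f : V * V -> R) (w : V * V -> V * V) p xi : O p ->
  ndiff 2 O f -> differentiable w p ->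
  'D_xi (fun q => 'D_(w q) f q) p =
  'D_xi ('D_(w p) f) p + 'D_('D_xi w p) f p.
Proof.
by move=> Op [df Df] dw; apply: (derive_dir oO) => // u; exact: (Df u).1.
Qed.

Lemma pair_differentiable (a b : V * V -> V) p :
  differentiable a p -> differentiable b p ->
  differentiable (fun q => (a q, b q)) p.
Proof. exact: differentiable_pair. Qed.

Lemma derive_pair (a b : V * V -> V) p xi :
  differentiable a p -> differentiable b p ->
  'D_xi (fun q => (a q, b q)) p = ('D_xi a p, 'D_xi b p).
Proof.
move=> da db; rewrite !deriveE//; last exact: pair_differentiable.
by rewrite diff_pair.
Qed.

Lemma gamma_linear : linear (@gamma R n).
Proof. by move=> c u v; rewrite /gamma; congr pair; rewrite /= scaler0 addr0. Qed.

Lemma gamma0 : gamma 0 = 0 :> V * V. Proof. by []. Qed.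

Lemma gammaZ c (u : V) : gamma (c *: u) = c *: gamma u.
Proof. by have := gamma_linear c u 0; rewrite gamma0 !addr0. Qed.

Lemma gammaD (u v : V) : gamma (u + v) = gamma u + gamma v.
Proof. by have := gamma_linear 1 u v; rewrite !scale1r. Qed.

Lemma gammaN (u : V) : gamma (- u) = - gamma u.
Proof. by rewrite -scaleN1r gammaZ scaleN1r. Qed.

Lemma gamma_continuous : continuous (@gamma R n).
Proof.
move=> x; apply: (@differentiable_continuous _ _ _ _ (fun w : V => (0, w))).
exact: (differentiable_pair (differentiable_cst (0 : V) x)).
Qed.

Lemma derive_snd p xi : 'D_xi (@snd V V) p = xi.2.
Proof.
rewrite (derive_linear_comp (@psnd_linear R n) (@psnd_continuous R n) (f := id))//.
by rewrite derive_id.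
Qed.

Lemma derive_gamma (a : V * V -> V) p xi : differentiable a p ->
  'D_xi (fun q => gamma (a q)) p = gamma ('D_xi a p).
Proof. by move=> da; rewrite (derive_linear_comp gamma_linear gamma_continuous). Qed.

Lemma differentiable_gamma (a : V * V -> V) p : differentiable a p ->
  differentiable (fun q => gamma (a q)) p.
Proof. exact: (linear_comp_differentiable gamma_linear gamma_continuous). Qed.

Lemma differentiable_psnd (p : V * V) : differentiable (@snd V V) p.
Proof.
exact: (linear_fun_differentiable (@psnd_linear R n) (@psnd_continuous R n)).
Qed.
End NdiffChart.

(** * Sprays and concurrent fields in a chart *)

Section Concurrent.
Context (R : realType) (n : nat).
Local Notation V := 'rV[R]_n.
Variables (O : set (V * V)) (E : V * V -> R) (g phi : V * V -> V).

Definition spray_of (g : V * V -> V) (q : V * V) : V * V := (q.2, g q).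
(** In the classical notation G = y^i d/dx^i - 2 G^i d/dy^i, g has the components - 2 G^i, so the
    second entry is minus the nonlinear connection coefficients applied to a. *)
Definition hlift (g : V * V -> V) (a : V) (q : V * V) : V * V :=
  (a, 2^-1 *: 'D_(gamma a) g q).
(** This is g(phi, eta): by Euler's theorem, contracting the vertical Hessian of the 2-homogeneous E
    with y gives its vertical derivative. *)
Definition Phi_of (E : V * V -> R) (phi : V * V -> V) (q : V * V) : R :=
  'D_(gamma (phi q)) E q.

Local Notation G := (spray_of g).
Local Notation Phi := (Phi_of E phi).

Hypothesis oO : open O.
Hypotheses (nE : ndiff 3 O E) (ng : ndiff 2 O g) (nphi : ndiff 2 O phi).
Hypothesis euler_lagrange : forall p a, O p ->
  'D_(G p) ('D_(gamma a) E) p = 'D_(a, 0) E p.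
Hypothesis E_const : forall p, O p -> 'D_(G p) E p = 0.
Hypothesis g_homo : forall p, O p -> 'D_(gamma p.2) g p = 2 *: g p.
Hypothesis E_homo : forall p, O p -> 'D_(gamma p.2) E p = 2 * E p.
Hypothesis phi_vert : forall p a, O p -> 'D_(gamma a) phi p = 0.
Hypothesis phi_hor : forall p a, O p ->
  'D_(hlift g a p) phi p = 2^-1 *: 'D_(gamma (phi p)) ('D_(gamma a) g) p - a.
Hypothesis phi_cartan : forall p u z, O p ->
  'D_(gamma u) (fun q => 'D_(gamma (phi q)) ('D_(gamma z) E) q) p = 0.

Let dg p : O p -> differentiable g p. Proof. by move/ng.1. Qed.
Let ddg a p : O p -> differentiable ('D_(gamma a) g) p.
Proof. by case: (ng.2 (gamma a)) => H _ /H. Qed.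
Let dE p : O p -> differentiable E p. Proof. by move/nE.1. Qed.
Let dphi p : O p -> differentiable phi p. Proof. by move/nphi.1. Qed.
Let nE2 : ndiff 2 O E. Proof. exact: ndiffS nE. Qed.

Lemma differentiable_spray_of p : O p -> differentiable G p.
Proof.
move=> Op; apply: pair_differentiable; last exact: dg.
exact: differentiable_psnd.
Qed.

Lemma derive_spray_of p xi : O p -> 'D_xi G p = (xi.2, 'D_xi g p).
Proof.
move=> Op; rewrite derive_pair ?derive_snd//; last exact: dg.
exact: differentiable_psnd.
Qed.

Lemma differentiable_hlift a p : O p -> differentiable (hlift g a) p.
Proof.
move=> Op; apply: pair_differentiable; first exact: differentiable_cst.
exact/differentiableZ/ddg.
Qed.

Lemma derive_hlift a p xi : O p ->
  'D_xi (hlift g a) p = gamma (2^-1 *: 'D_xi ('D_(gamma a) g) p).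
Proof.
move=> Op; rewrite derive_pair.
- by rewrite derive_cst deriveZ//; exact/diff_derivable/ddg.
- exact: differentiable_cst.
- exact/differentiableZ/ddg.
Qed.

Lemma derive_hliftE (f : V * V -> R) a p : differentiable f p ->
  2 * 'D_(hlift g a p) f p = 'D_((a, 0)) f p + 'D_((a, 'D_(gamma a) g p)) f p.
Proof.
move=> df; rewrite -(deriveD_dir (a, 0) (a, 'D_(gamma a) g p) df).
transitivity ('D_(2 *: hlift g a p) f p); first by rewrite (deriveZ_dir _ _ df).
congr ('D__ f p); rewrite /hlift; congr pair; rewrite /=.
  by rewrite scaler_nat mulr2n.
by rewrite add0r scalerA mulfV ?scale1r// pnatr_eq0.
Qed.

(** Commuting D_{(0,a)} with D_G produces the bracket of gamma a with G, which is (a, D_{(0,a)} g),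
    that is, twice the horizontal lift of a minus (a, 0). This ties the Euler-Lagrange expression of
    f to its horizontal derivative. *)
Lemma vert_derive_spray (f : V * V -> R) a p : ndiff 2 O f -> O p ->
  'D_(gamma a) (fun q => 'D_(G q) f q) p =
  'D_(G p) ('D_(gamma a) f) p - 'D_(a, 0) f p + 2 * 'D_(hlift g a p) f p.
Proof.
move=> nf Op; rewrite (derive_hliftE _ (nf.1 p Op)) addrA subrK.
rewrite (derive_dir_ndiff oO _ Op nf (differentiable_spray_of Op)).
by rewrite (derive_swap_ndiff _ _ oO Op nf) (derive_spray_of _ Op).
Qed.

(* Differentiate D_G E = 0 vertically and use the Euler-Lagrange equations. *)
Lemma derive_hlift_energy a p : O p -> 'D_(hlift g a p) E p = 0.
Proof.
move=> Op; have := vert_derive_spray a nE2 Op.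
rewrite euler_lagrange// subrr add0r.
have -> : 'D_(gamma a) (fun q => 'D_(G q) E q) p = 0.
  rewrite -(derive_cst (0 : R) p (gamma a)).
  exact: derive_eq_on oO Op E_const.
by move/esym/eqP; rewrite mulf_eq0 pnatr_eq0 => /eqP.
Qed.

Lemma Phi_ndiff : ndiff 2 O Phi.
Proof.
apply: ndiff_dir => //; apply: ndiff_linear => //.
  exact: gamma_linear.
exact: gamma_continuous.
Qed.

Lemma derive_Phi p xi : O p ->
  'D_xi Phi p = 'D_xi ('D_(gamma (phi p)) E) p + 'D_(gamma ('D_xi phi p)) E p.
Proof.
move=> Op; rewrite -(derive_gamma xi (dphi Op)).
apply: (derive_dir_ndiff oO xi (w := fun q => gamma (phi q)) Op nE2).
by apply: differentiable_gamma; exact: dphi.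
Qed.

(* The second vertical derivatives of g that come from the Berwald equation for
   phi cancel those obtained by differentiating D_{beta a} E = 0 along phi. *)
Lemma derive_hlift_Phi a p : O p ->
  'D_(hlift g a p) Phi p = - 'D_(gamma a) E p.
Proof.
move=> Op; rewrite derive_Phi// phi_hor//.
have H : 'D_(gamma (phi p)) (fun q => 'D_(hlift g a q) E q) p = 0.
  rewrite (derive_eq_on (g := cst 0) _ oO Op) ?derive_cst// => q Oq.
  exact: derive_hlift_energy.
move: H; rewrite (derive_dir_ndiff oO (w := hlift g a))//;
  last exact: differentiable_hlift.
rewrite (derive_swap_ndiff _ _ oO)// derive_hlift// => H.
rewrite -[RHS]add0r -{}H -addrA; congr (_ + _).
by rewrite gammaD gammaN -scaleN1r deriveD_dir ?deriveZ_dir ?scaleN1r//; exact: dE.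
Qed.

(** The spray is horizontal because g is 2-homogeneous: half of D_C g is g. *)
Lemma hlift_self p : O p -> hlift g p.2 p = G p.
Proof.
by move=> Op; rewrite /hlift /spray_of g_homo// scalerA mulVf ?scale1r.
Qed.

Lemma spray_Phi p : O p -> 'D_(G p) Phi p = - (2 * E p).
Proof. by move=> Op; rewrite -hlift_self// derive_hlift_Phi// E_homo. Qed.

(** In [vert_derive_spray] for Phi, the left side and the horizontal term both equal - 2 D_{(0,a)}
    E, so the Euler-Lagrange expression vanishes. *)
Lemma euler_lagrange_Phi p a : O p ->
  'D_(G p) ('D_(gamma a) Phi) p = 'D_(a, 0) Phi p.
Proof.
move=> Op; have H : 'D_(gamma a) (fun q => 'D_(G q) Phi q) p =
    - (2 * 'D_(gamma a) E p).
  rewrite (derive_eq_on (g := fun q => - 2 * E q) _ oO Op) => [|q Oq].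
    by rewrite deriveMl ?mulNr//; exact/diff_derivable/dE.
  by rewrite spray_Phi// mulNr.
have cancel (A x y z t : R) : A = x - y + 2 * z -> A = - (2 * t) -> z = - t -> x = y.
  by move=> *; lra.
exact: cancel (vert_derive_spray a Phi_ndiff Op) H (derive_hlift_Phi a Op).
Qed.

Lemma vert_Phi p z : O p ->
  'D_(gamma z) Phi p = 'D_(gamma (phi p)) ('D_(gamma z) E) p.
Proof.
move=> Op; rewrite derive_Phi// phi_vert//.
by rewrite (derive_swap_ndiff _ _ oO)// [gamma 0](_ : _ = 0)// derive0 addr0.
Qed.

Lemma vert2_Phi p u z : O p -> 'D_(gamma u) ('D_(gamma z) Phi) p = 0.
Proof.
move=> Op; rewrite -(phi_cartan u z Op); apply: derive_eq_on oO Op _ => q Oq.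
exact: vert_Phi.
Qed.

(** The vertical derivative of a 2-homogeneous function is 1-homogeneous: differentiate Euler's
    identity for E along z. *)
Lemma euler_vert p z : O p ->
  'D_(gamma p.2) ('D_(gamma z) E) p = 'D_(gamma z) E p.
Proof.
move=> Op; have H : 'D_(gamma z) (fun q => 'D_(gamma q.2) E q) p =
    2 * 'D_(gamma z) E p.
  rewrite (derive_eq_on _ oO Op E_homo) -deriveMl//.
  exact/diff_derivable/dE.
move: H; rewrite (derive_dir_ndiff oO (w := fun q => gamma q.2))//; last first.
  by apply: differentiable_gamma; exact: differentiable_psnd.
rewrite derive_gamma ?derive_snd/=; last exact: differentiable_psnd.
by rewrite (derive_swap_ndiff _ _ oO)//; lra.
Qed.

Lemma Phi_homo p : O p -> 'D_(gamma p.2) Phi p = Phi p.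
Proof.
by move=> Op; rewrite vert_Phi// (derive_swap_ndiff _ _ oO)// euler_vert.
Qed.
End Concurrent.

(** * Derivatives of F^4 / (2 (F - P)^2) *)

Section MatsumotoDerivatives.
Context (R : realType) (U : normedModType R).
Variables (F P : U -> R) (p v : U) (dF dP : R).
Hypotheses (hF : is_derive p v F dF) (hP : is_derive p v P dP).
Hypothesis s0 : F p - P p != 0.

Definition matsumoto_energy (F P : U -> R) q := (F q ^+ 2 / (F q - P q)) ^+ 2 / 2.
(* The partial derivatives of F^4 / (2 (F - P)^2) with respect to F and P. *)
Definition matsumoto_dF (F P : U -> R) q := F q ^+ 3 * (F q - 2 * P q) / (F q - P q) ^+ 3.
Definition matsumoto_dP (F P : U -> R) q := F q ^+ 4 / (F q - P q) ^+ 3.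

Let c (q : U) : R := (F q - P q)^-1.

Let hc : is_derive p v c (- (F p - P p) ^- 2 * (dF - dP)).
Proof.
have [ds <-] : is_derive p v (F - P) (dF - dP) by exact: is_deriveB.
split; first exact: (@derivableV _ _ (F - P)).
exact: (@deriveV _ _ (F - P)).
Qed.

Lemma is_derive_matsumoto_energy : is_derive p v (matsumoto_energy F P)
  (matsumoto_dF F P p * dF + matsumoto_dP F P p * dP).
Proof.
(* As a product of functions with the inverse isolated in [c], the energy is differentiated by the
   product rule alone. *)
have -> : matsumoto_energy F P = F * F * (F * F) * (c * c) * cst (2^-1).
  apply/funext => q; rewrite /matsumoto_energy /c !fctE.
  by move: (_^-1) (2^-1) => k l; ring.
have h2 : is_derive p v (F * F) _ := is_deriveM hF hF.
have h4 : is_derive p v (F * F * (F * F)) _ := is_deriveM h2 h2.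
have hc2 : is_derive p v (c * c) _ := is_deriveM hc hc.
have h := is_deriveM (is_deriveM h4 hc2) (is_derive_cst (2^-1 : R) p v).
apply: (@is_derive_eq _ _ _ _ _ _ _ _ h).
rewrite /matsumoto_dF /matsumoto_dP /c !fctE /GRing.scale /=.
by field.
Qed.

(** The coefficients here and in [is_derive_matsumoto_dP] are the second partial derivatives with
    respect to F and P; the mixed one, F^3 (F - 4 P) / (F - P)^4, is common to both. *)
Lemma is_derive_matsumoto_dF : is_derive p v (matsumoto_dF F P)
  (F p ^+ 2 * (F p ^+ 2 - 4 * F p * P p + 6 * P p ^+ 2) / (F p - P p) ^+ 4 * dF
   + F p ^+ 3 * (F p - 4 * P p) / (F p - P p) ^+ 4 * dP).
Proof.
have -> : matsumoto_dF F P = F * F * F * (F - P - P) * (c * c * c).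
  apply/funext => q; rewrite /matsumoto_dF /c !fctE -exprVn.
  by move: (_^-1) => k; ring.
have h3 : is_derive p v (F * F * F) _ := is_deriveM (is_deriveM hF hF) hF.
have hl : is_derive p v (F - P - P) _ := is_deriveB (is_deriveB hF hP) hP.
have hc3 : is_derive p v (c * c * c) _ := is_deriveM (is_deriveM hc hc) hc.
have h := is_deriveM (is_deriveM h3 hl) hc3.
apply: (@is_derive_eq _ _ _ _ _ _ _ _ h).
by rewrite /c !fctE /GRing.scale /=; field.
Qed.

Lemma is_derive_matsumoto_dP : is_derive p v (matsumoto_dP F P)
  (F p ^+ 3 * (F p - 4 * P p) / (F p - P p) ^+ 4 * dF
   + 3 * F p ^+ 4 / (F p - P p) ^+ 4 * dP).
Proof.
have -> : matsumoto_dP F P = F * F * (F * F) * (c * c * c).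
  apply/funext => q; rewrite /matsumoto_dP /c !fctE -exprVn.
  by move: (_^-1) => k; ring.
have h2 : is_derive p v (F * F) _ := is_deriveM hF hF.
have h4 : is_derive p v (F * F * (F * F)) _ := is_deriveM h2 h2.
have hc3 : is_derive p v (c * c * c) _ := is_deriveM (is_deriveM hc hc) hc.
have h := is_deriveM h4 hc3.
apply: (@is_derive_eq _ _ _ _ _ _ _ _ h).
by rewrite /c !fctE /GRing.scale /=; field.
Qed.
End MatsumotoDerivatives.

(** On a vertical first argument dd_J E reduces to the vertical Hessian of E, so the hypothesis on w
    places (0, w) in the left kernel of an invertible matrix. *)
Lemma max_rank_vertical (R : realType) (n : nat) (E : 'rV[R]_n * 'rV[R]_n -> R)
    p (w : 'rV[R]_n) :
  (forall u, differentiable ('D_u E) p) -> max_rank (ddJ E p) ->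
  (forall a, 'D_(gamma w) ('D_(gamma a) E) p = 0) -> w = 0.
Proof.
move=> dE; rewrite /max_rank; set A := \matrix_(_, _) _ => rA w0.
have fA : row_free A by rewrite /row_free rA.
have : row_mx 0 w *m A = 0.
  apply/rowP => l; rewrite !mxE; set z := gamma (frame R l).1.
  transitivity ('D_(gamma w) ('D_z E) p); last exact: w0.
  rewrite [in RHS](fcoord_frame (gamma w)) derive_sum_dir; last exact: dE.
  apply: eq_bigr => k _; rewrite -[RHS]/(_ * _).
  rewrite [A k l]mxE; have [j kE|j kE] := fintype.splitP k.
    have -> : k = lshift n j by exact: val_inj.
    by rewrite /fcoord !row_mxEl !mxE !mul0r.
  have -> : k = rshift n j by exact: val_inj.
  rewrite /fcoord /gamma /= /ddJ /ext_d; congr (_ * _).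
  (* The second term of [ext_d] evaluates d_J E on a vertical frame vector, where it is identically
     0. *)
  rewrite -[RHS]subr0; congr (_ - _).
  apply: etrans (derive_cst (0 : R) p (frame R l)).
  congr (derive _ p _); apply/funext => q.
  rewrite /dJ /vJ /rho (_ : (frame R _).1 = 0) ?gamma0 ?derive0//.
  by apply/rowP => i; rewrite /frame /= !mxE eq_lrshift.
move/eqP; rewrite mulmx_free_eq0// => /eqP/(congr1 rsubmx).
by rewrite row_mxKr linear0.
Qed.

(** * The spray of the Matsumoto energy *)

Section MatsumotoSpray.
Context (R : realType) (n : nat).
Local Notation V := 'rV[R]_n.
Variables (O : set (V * V)) (F P : V * V -> R) (g phi : V * V -> V).
Local Notation G := (spray_of g).
Local Notation E := (fun q => F q ^+ 2 / 2).
Local Notation Eh := (matsumoto_energy F P).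

Hypothesis oO : open O.
Hypotheses (nF : ndiff 3 O F) (nP : ndiff 2 O P).
Hypothesis F0 : forall p, O p -> F p != 0.
Hypothesis s0 : forall p, O p -> F p - P p != 0.
Hypothesis euler_lagrange : forall p a, O p ->
  'D_(G p) ('D_(gamma a) E) p = 'D_(a, 0) E p.
Hypothesis E_const : forall p, O p -> 'D_(G p) E p = 0.
Hypothesis F_homo : forall p, O p -> 'D_(gamma p.2) F p = F p.
Hypothesis PE : forall p, O p -> P p = 'D_(gamma (phi p)) E p.
Hypothesis spray_P : forall p, O p -> 'D_(G p) P p = - (2 * E p).
Hypothesis euler_lagrange_P : forall p a, O p ->
  'D_(G p) ('D_(gamma a) P) p = 'D_(a, 0) P p.
Hypothesis vert_P : forall p z, O p ->
  'D_(gamma z) P p = 'D_(gamma (phi p)) ('D_(gamma z) E) p.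
Hypothesis vert2_P : forall p u z, O p -> 'D_(gamma u) ('D_(gamma z) P) p = 0.
Hypothesis P_homo : forall p, O p -> 'D_(gamma p.2) P p = P p.

Let dF p : O p -> differentiable F p. Proof. by move/nF.1. Qed.
Let ddF a p : O p -> differentiable ('D_a F) p.
Proof. by case: (nF.2 a) => H _ /H. Qed.
Let dP p : O p -> differentiable P p. Proof. by move/nP.1. Qed.
Let ddP a p : O p -> differentiable ('D_a P) p.
Proof. by case: (nP.2 a) => H _ /H. Qed.
Let nF2 : ndiff 2 O F. Proof. exact: ndiffS. Qed.

Lemma derive_half_sqr p v : O p -> 'D_v E p = F p * 'D_v F p.
Proof.
move=> Op; have hF := diff_is_derive v (dF Op).
have h := is_deriveM (is_deriveM hF hF) (is_derive_cst (2^-1 : R) p v).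
have -> : E = F * F * cst 2^-1 by apply/funext => q; rewrite !fctE expr2.
rewrite (@derive_val _ _ _ _ _ _ _ h) !fctE /GRing.scale /=.
by field.
Qed.

Lemma derive2_half_sqr p u v : O p ->
  'D_u ('D_v E) p = F p * 'D_u ('D_v F) p + 'D_v F p * 'D_u F p.
Proof.
move=> Op; rewrite (derive_eq_on (g := F * 'D_v F) u oO Op); last first.
  by move=> q Oq; exact: derive_half_sqr.
by rewrite deriveM//; apply: diff_derivable; [exact: dF|exact: ddF].
Qed.

Lemma spray_F p : O p -> 'D_(G p) F p = 0.
Proof.
move=> Op; have := E_const Op; rewrite derive_half_sqr// => /eqP.
by rewrite mulf_eq0 (negbTE (F0 Op)) => /eqP.
Qed.

Lemma euler_lagrange_F p a : O p ->
  'D_(G p) ('D_(gamma a) F) p = 'D_(a, 0) F p.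
Proof.
move=> Op; have := euler_lagrange a Op.
rewrite derive2_half_sqr// derive_half_sqr// spray_F// mulr0 addr0.
exact: mulfI (F0 Op) _ _.
Qed.

Lemma euler_vert_F p z : O p -> 'D_(gamma p.2) ('D_(gamma z) F) p = 0.
Proof.
move=> Op.
have H : 'D_(gamma z) (fun q => 'D_(gamma q.2) F q) p = 'D_(gamma z) F p.
  exact: derive_eq_on oO Op F_homo.
have dy : differentiable (fun q : V * V => gamma q.2) p.
  by apply: differentiable_gamma; exact: differentiable_psnd.
move: H; rewrite (derive_dir_ndiff oO _ Op nF2 dy).
rewrite derive_gamma ?derive_snd/=; last exact: differentiable_psnd.
rewrite (derive_swap_ndiff _ _ oO Op nF2) => /eqP.
by rewrite -subr_eq0 addrK => /eqP.
Qed.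

Lemma vert_phi_F p : O p -> 'D_(gamma (phi p)) F p = P p / F p.
Proof.
move=> Op; rewrite (PE Op) derive_half_sqr// mulrC mulKf//; exact: F0.
Qed.

(** Obtained by solving the second derivative of E = F^2 / 2 for that of F, the derivative of F
    along phi being P / F. *)
Lemma vert2_phi_F p a : O p -> 'D_(gamma (phi p)) ('D_(gamma a) F) p =
  ('D_(gamma a) P p - 'D_(gamma a) F p * (P p / F p)) / F p.
Proof.
move=> Op; rewrite (vert_P _ Op) derive2_half_sqr// vert_phi_F// addrK.
by rewrite mulrC mulKf//; exact: F0.
Qed.

Local Notation h1 := (matsumoto_dF F P).
Local Notation h2 := (matsumoto_dP F P).

Lemma derive_matsumoto p v : O p ->
  'D_v Eh p = h1 p * 'D_v F p + h2 p * 'D_v P p.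
Proof.
move=> Op; have h := is_derive_matsumoto_energy
  (diff_is_derive v (dF Op)) (diff_is_derive v (dP Op)) (s0 Op).
exact: (@derive_val _ _ _ _ _ _ _ h).
Qed.

Lemma derive2_matsumoto p u v : O p ->
  'D_u ('D_v Eh) p =
  h1 p * 'D_u ('D_v F) p + 'D_v F p *
   (F p ^+ 2 * (F p ^+ 2 - 4 * F p * P p + 6 * P p ^+ 2) / (F p - P p) ^+ 4
      * 'D_u F p
    + F p ^+ 3 * (F p - 4 * P p) / (F p - P p) ^+ 4 * 'D_u P p)
  + (h2 p * 'D_u ('D_v P) p + 'D_v P p *
   (F p ^+ 3 * (F p - 4 * P p) / (F p - P p) ^+ 4 * 'D_u F p
    + 3 * F p ^+ 4 / (F p - P p) ^+ 4 * 'D_u P p)).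
Proof.
move=> Op; rewrite (derive_eq_on (g := h1 * 'D_v F + h2 * 'D_v P) u oO Op);
  last by move=> q Oq; exact: derive_matsumoto.
have hF := diff_is_derive u (dF Op).
have hP := diff_is_derive u (dP Op).
have hFv := diff_is_derive u (ddF v Op).
have hPv := diff_is_derive u (ddP v Op).
have k1 := is_deriveM (is_derive_matsumoto_dF hF hP (s0 Op)) hFv.
have k2 := is_deriveM (is_derive_matsumoto_dP hF hP (s0 Op)) hPv.
have k := is_deriveD k1 k2.
exact: (@derive_val _ _ _ _ _ _ _ k).
Qed.

(** Once all derivatives are substituted, the terms in D_{(a,0)} F and D_{(a,0)} P agree on both
    sides. The coefficients of D_{(0,a)} F and D_{(0,a)} P then give two linear equations for f1 and
    f2, whose determinant is K up to the factor - F^6 / (F - P)^6. The derivative of P along phi is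
    p^2. *)
Lemma matsumoto_spray_deviation (f1 f2 : R) p a :
  O p ->
  let K := F p * (1 + 2 * 'D_(gamma (phi p)) P p) - 3 * P p in
  K != 0 ->
  f1 = F p * (4 * P p - F p) / K -> f2 = 2 * F p ^+ 3 / K ->
  'D_(G p) ('D_(gamma a) Eh) p + (- f1 * 'D_(gamma p.2) ('D_(gamma a) Eh) p
    + f2 * 'D_(gamma (phi p)) ('D_(gamma a) Eh) p) = 'D_(a, 0) Eh p.
Proof.
move=> Op K K0 -> ->; rewrite derive_matsumoto// !derive2_matsumoto//.
rewrite !vert2_P// spray_P// spray_F// euler_lagrange_F// euler_lagrange_P//.
rewrite euler_vert_F// vert2_phi_F// vert_phi_F// P_homo// F_homo//.
rewrite /K /matsumoto_dF /matsumoto_dP.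
move: K0 (F0 Op) (s0 Op); rewrite /K.
move: (F p) (P p) ('D_(gamma a) F p) ('D_(gamma a) P p) ('D_(a, 0) F p) ('D_(a, 0) P p) ('D_(gamma (phi p)) P p).
move=> f q fa qa f' q' pp K0 f0 sn0.
by field; rewrite f0 sn0 K0.
Qed.

Section Uniqueness.
Variables (gh : V * V -> V).
Hypothesis nEh : ndiff 2 O Eh.
Hypothesis rankEh : forall p, O p -> max_rank (ddJ Eh p).
Hypothesis euler_lagrange_hat : forall p a, O p ->
  'D_(spray_of gh p) ('D_(gamma a) Eh) p = 'D_(a, 0) Eh p.

(** Both sprays satisfy the same Euler-Lagrange equations, so their difference is a vertical vector
    annihilated by the vertical Hessian of the energy, hence 0. *)
Lemma matsumoto_spray (f1 f2 : R) p :
  O p ->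
  let K := F p * (1 + 2 * 'D_(gamma (phi p)) P p) - 3 * P p in
  K != 0 ->
  f1 = F p * (4 * P p - F p) / K -> f2 = 2 * F p ^+ 3 / K ->
  gh p = g p - f1 *: p.2 + f2 *: phi p.
Proof.
move=> Op K K0 f1E f2E; apply/eqP; rewrite -subr_eq0; apply/eqP.
have dEh u : differentiable ('D_u Eh) p by case: (nEh.2 u) => H _; exact: H.
apply: (max_rank_vertical dEh (rankEh Op)) => a.
have cancel (x y z t : R) : x = y -> t = x + z -> y = t -> z = 0.
  by move=> -> -> /eqP; rewrite -subr_eq0 opprD addrA subrr add0r oppr_eq0 => /eqP.
apply: cancel (matsumoto_spray_deviation a Op K0 f1E f2E) _ _.
- exact: derive_comb3 (dEh (gamma a)).
(* The four directions add up to [spray_of gh p]: its vertical part is g, the two corrections and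
   the difference that is to vanish. *)
- rewrite -(euler_lagrange_hat a Op); congr (derive _ p _).
  rewrite /spray_of /gamma; congr pair; rewrite /= ?scaler0 ?addr0//.
  rewrite scaleNr.
  set x := f1 *: _; set y := f2 *: _; rewrite !opprD opprK.
  by apply/rowP => i; rewrite !mxE; ring.
Qed.
End Uniqueness.
End MatsumotoSpray.

(** * Vector-valued functions, coordinate by coordinate *)

Lemma differentiable_coordP (R : realType) (n : nat) (U : normedModType R)
    (f : U -> 'rV[R]_n) p :
  (forall j, differentiable (fun q => f q 0 j) p) -> differentiable f p.
Proof.
move=> hf; have -> : f = \sum_j (fun q => f q 0 j *: (delta_mx 0 j : 'rV[R]_n)).
  by apply/funext => q; rewrite fct_sumE; exact: row_sum_delta.
by apply: differentiable_sum => j; exact: differentiableZl.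
Qed.

Section VectorValued.
Context (R : realType) (n : nat).
Local Notation V := 'rV[R]_n.
Variables (O : set (V * V)).
Hypothesis oO : open O.

Lemma coord_linear (j : 'I_n) : linear (fun M : V => M 0 j).
Proof. by move=> c u v; rewrite !mxE. Qed.

Lemma vcoord_continuous (j : 'I_n) : continuous (fun M : V => M 0 j).
Proof. exact: coord_continuous. Qed.

Lemma ndiff_coordP k (f : V * V -> V) :
  (forall j, ndiff k O (fun q => f q 0 j)) -> ndiff k O f.
Proof.
elim: k f => // k IH f hf.
have df p : O p -> differentiable f p.
  by move=> Op; apply: differentiable_coordP => j; exact: (hf j).1.
split=> // v; apply: IH => j; apply: ndiff_eq oO _ ((hf j).2 v) => q Oq.
exact: (derive_linear_comp (@coord_linear j) (@vcoord_continuous j)  _ (df q Oq)).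
Qed.

Lemma ndiff_dirV k (f : V * V -> V) (w : V * V -> V * V) :
  ndiff k.+1 O f -> ndiff k O w -> ndiff k O (fun q => 'D_(w q) f q).
Proof.
move=> hf hw; apply: ndiff_coordP => j.
apply: ndiff_eq oO _ (ndiff_dir oO (f := fun q => f q 0 j) _ hw) => [q Oq|].
  apply: (derive_linear_comp (@coord_linear j) (@vcoord_continuous j)).
  exact: hf.1.
exact: ndiff_linear (@coord_linear j) (@vcoord_continuous j) oO hf.
Qed.

Lemma derive_fst (X : V * V -> V * V) p xi : differentiable X p ->
  ('D_xi X p).1 = 'D_xi (fun q => (X q).1) p.
Proof.
by move=> dX; rewrite (derive_linear_comp (@pfst_linear R n) (@pfst_continuous R n)).
Qed.

Lemma ndiff_pair k (a b : V * V -> V) :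
  ndiff k O a -> ndiff k O b -> ndiff k O (fun q => (a q, b q)).
Proof.
elim: k a b => // k IH a b [da Da] [db Db]; split=> [p Op|v].
  by apply: pair_differentiable; [exact: da|exact: db].
apply: ndiff_eq oO _ (IH _ _ (Da v) (Db v)) => q Oq.
by rewrite derive_pair//; [exact: da|exact: db].
Qed.

Lemma ndiff_gamma k (a : V * V -> V) : ndiff k O a ->
  ndiff k O (fun q => gamma (a q)).
Proof. exact: ndiff_pair (ndiff_cst _ _ _). Qed.
End VectorValued.

Lemma scale_half (R : numFieldType) (V : lmodType R) (u : V) :
  2^-1 *: (u + u) = u.
Proof. by rewrite -mulr2n -(scaler_nat 2 u) scalerA mulVf ?scale1r// pnatr_eq0. Qed.

Lemma rho_bracketC (R : realType) (n : nat)
    (X Y : 'rV[R]_n * 'rV[R]_n -> 'rV[R]_n * 'rV[R]_n) p :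
  rho (bracket X Y p) = - rho (bracket Y X p).
Proof.
rewrite /bracket; move: ('D_(X p) Y p) ('D_(Y p) X p) => x y.
by rewrite /rho /= opprB.
Qed.

(** * Barthel, Berwald and Cartan connections in a chart *)

Section SprayConnection.
Context (R : realType) (n : nat).
Local Notation V := 'rV[R]_n.
Variables (O : set (V * V)) (G : V * V -> V * V).
Hypothesis oO : open O.
Hypothesis nG : ndiff 3 O G.
Hypothesis G1 : forall p, O p -> vJ (G p) = liouville p.
Let g q := (G q).2.

Lemma spray_fst p : O p -> (G p).1 = p.2.
Proof. by move/G1 => []. Qed.

Lemma sprayE p : O p -> G p = spray_of g p.
Proof. by move=> Op; rewrite /spray_of -(spray_fst Op) -surjective_pairing. Qed.

Lemma ndiff_snd_spray : ndiff 3 O g.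
Proof.
exact: ndiff_linear (@psnd_linear R n) (@psnd_continuous R n) oO nG.
Qed.

Let dg p : O p -> differentiable g p. Proof. by move/ndiff_snd_spray.1. Qed.

Lemma derive_spray p xi : O p -> 'D_xi G p = (xi.2, 'D_xi g p).
Proof.
by move=> Op; rewrite (derive_eq_on xi oO Op sprayE) (derive_spray_of (ndiffS ndiff_snd_spray)).
Qed.

(** The derivatives of X cancel between [JX, G] and J[X, G]: Gamma is a tensor, so only the value of
    X at p survives. *)
Lemma barthelE (X : V * V -> V * V) p : O p -> differentiable X p ->
  barthel G X p = ((X p).1, 'D_(gamma (X p).1) g p - (X p).2).
Proof.
move=> Op dX; rewrite /barthel /bracket /vJ /rho.
have d1 : differentiable (fun q => (X q).1) p.
  exact: (linear_comp_differentiable (@pfst_linear R n) (@pfst_continuous R n) dX).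
have -> : 'D_(G p) ((fun xi : V * V => gamma xi.1) \o X) p =
    gamma ('D_(G p) X p).1.
  rewrite (derive_fst _ dX); exact: derive_gamma.
rewrite !derive_spray//= /gamma; congr pair; rewrite /= ?subr0//.
by rewrite opprB addrA subrK.
Qed.

Lemma hprojE (X : V * V -> V * V) p : O p -> differentiable X p ->
  hproj G X p = hlift g (X p).1 p.
Proof.
move=> Op dX; rewrite /hproj barthelE// /hlift; congr pair; rewrite /=.
  exact: scale_half.
by rewrite addrC subrK.
Qed.

Lemma vproj_vertical (X : V * V -> V * V) p : O p -> differentiable X p ->
  (X p).1 = 0 -> vproj G X p = gamma (X p).2.
Proof.
move=> Op dX X0; rewrite /vproj barthelE// X0 gamma0 derive0 /gamma.
congr pair; rewrite /= ?X0 ?subr0 ?scaler0// sub0r opprK.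
exact: scale_half.
Qed.

(** A horizontal vector is determined by its image under rho, since [hproj] at p depends only on the
    first component of the field at p; hence [xget] has exactly one choice. *)
Lemma betaE (W : V * V -> V) p : O p -> beta G W p = hlift g (W p) p.
Proof.
move=> Op; rewrite /beta; apply: xget_unique.
  (* A constant field with the right first component is smooth and has the required projection. *)
  split=> //; exists (fun=> (W p, 0)).
    by exists O => //; exact: smooth_on_cst.
  by rewrite hprojE//; exact: differentiable_cst.
move=> xi [[X [A [_ Ap] sX] <-]].
have dX : differentiable X p := sX [::] p Ap.
by rewrite (hprojE Op dX) => WE; congr (hlift g _ p).
Qed.

Lemma ndiff_hlift (w : V * V -> V) : ndiff 2 O w ->
  ndiff 2 O (fun q => hlift g (w q) q).
Proof.
move=> nw; apply: ndiff_pair => //.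
apply: (@ndiff_linear _ _ _ _ ( *:%R (2^-1))) => //.
- by move=> c u v; rewrite scalerDr !scalerA mulrC.
- exact: scaler_continuous.
by apply: ndiff_dirV ndiff_snd_spray _ => //; exact: ndiff_gamma.
Qed.

Lemma differentiable_beta (W : V * V -> V) p : O p -> ndiff 2 O W ->
  differentiable (beta G W) p.
Proof.
move=> Op nW; apply: differentiable_eq_on oO Op _ ((ndiff_hlift nW).1 p Op).
by move=> q Oq; rewrite betaE.
Qed.

(** A vertical field contributes nothing to the first component, and that of beta W is W itself: the
    bracket reduces to a vertical derivative of W. *)
Lemma rho_bracket_beta (U W : V * V -> V) p : O p -> ndiff 2 O W ->
  differentiable U p ->
  rho (bracket (gamma (n := n) \o U) (beta G W) p) = 'D_(gamma (U p)) W p.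
Proof.
move=> Op nW dU; rewrite /rho /bracket /=.
rewrite (_ : 'D__ (gamma (n := n) \o U) p = gamma ('D_(beta G W p) U p));
  last exact: derive_gamma.
rewrite subr0 (derive_fst _ (differentiable_beta Op nW)).
by apply: derive_eq_on oO Op _ => q Oq; rewrite betaE.
Qed.

Variable phi : V * V -> V.
Hypothesis nphi : ndiff 3 O phi.

Lemma berwald_v_vert p a : O p -> berwald_v O G (fun=> a) phi (fun=> 0) ->
  'D_(gamma a) phi p = 0.
Proof.
move=> Op /(_ p Op) H; rewrite [RHS]H; apply: esym.
exact: (rho_bracket_beta (U := fun=> a) Op (ndiffS nphi) (differentiable_cst _ _)).
Qed.

(** The bracket of beta a with gamma phi is already vertical, so v fixes it, and the Berwald
    condition is read off its second component. *)
Lemma berwald_h_hor p a : O p ->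
  berwald_h O G (fun=> a) phi (fun=> - a) ->
  'D_(hlift g a p) phi p = 2^-1 *: 'D_(gamma (phi p)) ('D_(gamma a) g) p - a.
Proof.
move=> Op /(_ p Op).
pose Y q := gamma ('D_(hlift g a q) phi q
   - 2^-1 *: 'D_(gamma (phi q)) ('D_(gamma a) g) q).
have XE q : O q -> bracket (beta G (fun=> a)) (gamma (n := n) \o phi) q = Y q.
  move=> Oq; rewrite /bracket betaE//.
  have dphi : differentiable phi q by exact: nphi.1.
  rewrite (_ : 'D__ (gamma (n := n) \o phi) q = gamma ('D_(hlift g a q) phi q));
    last exact: derive_gamma.
  have -> : 'D_((gamma (n := n) \o phi) q) (beta G (fun=> a)) q =
     gamma (2^-1 *: 'D_(gamma (phi q)) ('D_(gamma a) g) q).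
    rewrite -(derive_hlift (ndiffS ndiff_snd_spray) a _ Oq).
    by apply: derive_eq_on oO Oq _ => r Or; rewrite betaE.
  by rewrite /Y gammaD gammaN.
(* [barthel] differentiates its argument, so the bracket must be differentiable at p. As Y contains
   second derivatives of g, this takes the third order of g. *)
have nY : ndiff 1 O Y.
  apply: ndiff_gamma => //; apply: ndiffD => //.
    apply: ndiff_dirV => //; first exact: ndiffS.
    by apply: ndiffS; apply: ndiff_hlift; exact: ndiff_cst.
  apply: (@ndiff_linear _ _ _ _ -%R) => //.
  - by move=> c u v; rewrite opprD scalerN.
  - exact: opp_continuous.
  apply: (@ndiff_linear _ _ _ _ ( *:%R (2^-1))) => //.
  - by move=> c u v; rewrite scalerDr !scalerA mulrC.
  - exact: scaler_continuous.
  apply: ndiff_dirV => //; first exact: ndiff_snd_spray.2.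
  by apply: ndiff_gamma => //; exact: ndiffW nphi.
have dX : differentiable (bracket (beta G (fun=> a)) (gamma (n := n) \o phi)) p.
  by apply: differentiable_eq_on oO Op _ (nY.1 p Op) => q Oq; rewrite XE.
rewrite (vproj_vertical Op dX) (XE p Op)// => -[/esym/eqP]; rewrite subr_eq addrC => /eqP ->.
by [].
Qed.

(** The other term of dd_J E differentiates d_J E on a vertical vector, which is 0 since J kills
    vertical vectors. *)
Lemma metricE (E : V * V -> R) p (w z : V) :
  metric E p w z = 'D_(gamma w) ('D_(gamma z) E) p.
Proof.
rewrite /metric /ddJ /ext_d -[RHS]subr0; congr (_ - _).
apply: etrans (derive_cst (0 : R) p (z, 0)); congr (derive _ p _).
by apply/funext => q; rewrite /dJ /vJ /rho /= gamma0 derive0.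
Qed.

(** For constant u and z the bracket terms are vertical derivatives of z and of phi, both 0, so the
    Cartan condition leaves the derivative of g(phi, z). It is stated on O' because its test fields
    are those smooth on its own domain; the constant z is one of them. *)
Lemma cartan_v_vert (E : V * V -> R) (O' : set (V * V)) p u z :
  O `<=` O' -> O p -> berwald_v O G (fun=> u) phi (fun=> 0) ->
  cartan_v O' E G (fun=> u) phi (fun=> 0) ->
  'D_(gamma u) (fun q => 'D_(gamma (phi q)) ('D_(gamma z) E) q) p = 0.
Proof.
move=> OO' Op /(_ p Op) bv.
move=> /(_ (fun=> z) (@smooth_on_cst _ _ _ O' z) p (OO' p Op)) cv.
have m0l w : metric E p 0 w = 0 by rewrite metricE gamma0 derive0.
have m0r w : metric E p w 0 = 0.
  rewrite metricE gamma0; apply: etrans (derive_cst (0 : R) p (gamma w)).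
  by congr (derive _ p _); apply/funext => q; rewrite derive0.
have r0 : rho (bracket (beta G (fun=> z)) (gamma (n := n) \o (fun=> u)) p) = 0.
  rewrite rho_bracketC; apply/eqP; rewrite oppr_eq0; apply/eqP.
  apply: etrans (derive_cst z p (gamma u)).
  exact: (rho_bracket_beta (U := fun=> u) (W := fun=> z) Op (ndiff_cst _ _ _)
     (differentiable_cst _ _)).
have comb (x a b c : R) : 2 * x = a + b + c -> x = 0 -> b = 0 -> c = 0 -> a = 0.
  by move=> xE x0 b0 c0; move: xE; rewrite x0 b0 c0 mulr0 !addr0.
have H := comb _ _ _ _ cv (m0l z)
  (etrans (congr1 (metric E p (phi p)) r0) (m0r _))
  (etrans (congr1 (metric E p z) (esym bv)) (m0r _)).
apply: etrans H; apply: derive_eq_on oO Op _ => q Oq.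
by rewrite metricE.
Qed.

Lemma spray_homo p : O p -> bracket (@liouville R n) G p = G p ->
  'D_(gamma p.2) g p = 2 *: g p.
Proof.
move=> Op; rewrite /bracket /liouville derive_gamma; last exact: differentiable_psnd.
rewrite derive_spray// derive_snd/= => /(congr1 snd) /= /eqP.
by rewrite subr_eq => /eqP ->; rewrite scaler_nat mulr2n.
Qed.

(** Evaluate i_G dd_J E = - dE on G itself, where the alternating form vanishes. *)
Lemma spray_energy_const (E : V * V -> R) p :
  (forall zeta, ddJ E p (G p) zeta = - 'D_zeta E p) -> 'D_(G p) E p = 0.
Proof.
move=> /(_ (G p)); rewrite /ddJ /ext_d subrr => /esym/eqP.
by rewrite oppr_eq0 => /eqP.
Qed.

(** Evaluate i_G dd_J E = - dE on (a, 0). Since JG = C, the second term of dd_J E is D_{(a,0)} D_C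
    E, which is 2 D_{(a,0)} E by Euler's theorem. *)
Lemma spray_euler_lagrange (E : V * V -> R) p a : O p -> ndiff 2 O E ->
  (forall q, O q -> 'D_(gamma q.2) E q = 2 * E q) ->
  (forall zeta, ddJ E p (G p) zeta = - 'D_zeta E p) ->
  'D_(G p) ('D_(gamma a) E) p = 'D_(a, 0) E p.
Proof.
move=> Op nE hE /(_ (a, 0)) sE.
have dy : differentiable (fun q : V * V => gamma q.2) p.
  by apply: differentiable_gamma; exact: differentiable_psnd.
(* C does not vary along (a, 0), so its direction may be frozen at p. *)
have dy0 : 'D_(a, 0) (fun q : V * V => gamma q.2) p = 0.
  exact: etrans (derive_gamma _ (differentiable_psnd p))
    (congr1 (@gamma R n) (derive_snd p (a, 0))).
have H : 'D_(a, 0) ('D_(gamma p.2) E) p = 2 * 'D_(a, 0) E p.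
  have := derive_dir_ndiff oO (a, 0) Op nE dy; rewrite dy0 derive0 addr0 => <-.
  apply: etrans (derive_eq_on (a, 0) oO Op hE) _.
  exact: deriveMl (diff_derivable (nE.1 p Op)).
have H' : derive (dJ E ^~ (G p)) p (a, 0) = 'D_(a, 0) ('D_(gamma p.2) E) p.
  have fE : dJ E ^~ (G p) = 'D_(gamma p.2) E.
    have := G1 Op; rewrite /liouville => <-.
    by apply/funext.
  exact: (congr1 (fun f : V * V -> R => derive f p ((a, 0) : V * V)) fE).
have comb (x y z : R) : x - y = - z -> y = 2 * z -> x = z.
  by move=> /eqP; rewrite subr_eq => /eqP -> ->; ring.
exact: comb sE (etrans H' H).
Qed.
End SprayConnection.

(** * Change of charts *)

Section ChartInvariance.
Context (R : realType) (n : nat) (M : smoothManifold R n).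
Local Notation V := 'rV[R]_n.
Implicit Types (i j : mindex M) (x : M) (a b w z : V) (p : V * V).

(* Transition maps are linear along the fibres: no regularity of f is needed. *)
Lemma fibre_derive (f f' : V * V -> R) (y y' : V) (A : V -> V) a w :
  linear A -> (forall b, f (y, b) = f' (y', A b)) ->
  'D_(gamma w) f (y, a) = 'D_(gamma (A w)) f' (y', A a).
Proof.
move=> lA ff'; have E (h : R) (u v c : V) :
    h *: gamma u + (v, c) = (v, h *: u + c).
  by rewrite /gamma; congr pair; rewrite /= scaler0 add0r.
have H : (fun h : R => h^-1 *: ((f \o shift (y, a)) (h *: gamma w) - f (y, a))) =
  (fun h : R => h^-1 *: ((f' \o shift (y', A a)) (h *: gamma (A w)) - f' (y', A a))).
  by apply/funext => h /=; rewrite !E !ff' lA.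
by rewrite /derive H.
Qed.

Lemma fibre_metric (f f' : V * V -> R) (y y' : V) (A : V -> V) a w z :
  linear A -> (forall b, f (y, b) = f' (y', A b)) ->
  metric f (y, a) w z = metric f' (y', A a) (A w) (A z).
Proof.
by move=> lA ff'; rewrite !metricE; apply: fibre_derive => // b; exact: fibre_derive.
Qed.

Lemma vec_comp_self i x a : chdom i x -> vec_comp i x a i = a.
Proof.
move=> xi; rewrite /vec_comp asboolT//.
have xO : (chart i @` chdom i) (chart i x) by exists x.
have H : 'D_a (trans i i) (chart i x) = 'D_a id (chart i x).
  apply: derive_eq_on (@image_open _ _ M i) xO _.
  by move=> _ [y yi <-]; rewrite /trans /= chartK.
by rewrite H derive_id.
Qed.

Lemma tangent_ext x (v w : tangent x) : tvcomp v = tvcomp w -> v = w.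
Proof.
case: v w => [v v1 v2] [w w1 w2] /= vw; rewrite -vw in w1 w2 *.
by congr Tangent; exact: Prop_irrelevance.
Qed.

(** The chain rule in [vec_comp_trans] gives equal components in every chart around x; in the other
    charts both are 0 by convention. *)
Lemma vec_change i j x a : chdom i x -> chdom j x ->
  vec j x (vec_comp i x a j) = vec i x a.
Proof.
move=> xi xj; rewrite /vec; congr existT; apply: tangent_ext => /=.
apply/funext => k; have [xk|xk] := pselect (chdom k x).
  by rewrite [RHS](vec_comp_trans i a xj xk) /vec_comp (asboolT (conj xj xk)).
by rewrite !vec_comp_out.
Qed.

Lemma chart_image i p : (chart i @` chdom i) p.1 ->
  chdom i (ichart i p.1) /\ chart i (ichart i p.1) = p.1.
Proof. by case=> x xi <-; rewrite chartK. Qed.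

Lemma tcoordK i p : (chart i @` chdom i) p.1 -> tcoord i (itcoord i p) = p.
Proof.
move=> /chart_image[xi xE]; rewrite /tcoord /itcoord /= xE vec_comp_self//.
by rewrite -surjective_pairing.
Qed.

Lemma etabarE i p : (chart i @` chdom i) p.1 -> piloc etabar i p = p.2.
Proof. by move=> /chart_image[xi _]; rewrite /piloc /= vec_comp_self. Qed.

(** The metric involves only derivatives along the fibre, on which the change from chart i to the
    chosen chart acts by the linear map [A]. *)
Lemma metric_at_chart (F : TM M -> R) i (u : TM M) (w z : tangent (tproj u)) :
  chdom i (tproj u) ->
  metric_at F w z =
  metric (floc (energy F) i) (tcoord i u) (tvcomp w i) (tvcomp z i).
Proof.
set x := tproj u => xi; rewrite /metric_at -/x.
set j := chart_at x; have xj : chdom j x by exact: chart_atP.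
pose A a := 'D_a (trans i j) (chart i x).
have lA : linear A.
  move=> c a b; have d := trans_differentiable xi xj.
  by rewrite /A deriveD_dir ?deriveZ_dir.
have tA (v : tangent x) : tvcomp v j = A (tvcomp v i) by exact: tvcomp_trans.
rewrite !tA /tcoord (tA (projT2 u)) -/x; apply/esym; apply: fibre_metric => // b.
rewrite /floc /itcoord /= !chartK//; congr (energy F _).
by rewrite -(vec_change b xi xj) /vec_comp asboolT.
Qed.

Lemma metric_at_loc (F : TM M -> R) (phi psi : pifield M) i p :
  (chart i @` chdom i) p.1 ->
  floc (fun u => metric_at F (phi u) (psi u)) i p =
  'D_(gamma (piloc phi i p)) ('D_(gamma (piloc psi i p)) (floc (energy F) i)) p.
Proof.
move=> pi; rewrite /floc (@metric_at_chart _ i); last exact: (chart_image pi).1.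
by rewrite tcoordK// metricE.
Qed.

(** Euler's theorem: differentiate F(x, (s + 1) y) = (s + 1) F(x, y) at s = 0, near which s + 1 is
    positive. *)
Lemma derive_homogeneous1 D (F : TM M -> R) i p :
  pos_homogeneous1 D F -> loc D i p -> differentiable (floc F i) p ->
  'D_(gamma p.2) (floc F i) p = floc F i p.
Proof.
move=> hF Dp dF; set f := floc F i.
have d0 : differentiable f (0 *: gamma p.2 + p) by rewrite scale0r add0r.
have [_] := is_derive_line d0; rewrite scale0r add0r => <-.
have hl : is_derive (0 : R) 1 (fun s : R => (s + 1) * f p) (f p).
  have i1 : is_derive (0 : R) 1 (@id R) 1 by exact: is_derive_id.
  have c1 c : is_derive (0 : R) 1 (cst (c : R)) 0 by exact: is_derive_cst.
  have h := is_deriveM (is_deriveD i1 (c1 1)) (c1 (f p)).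
  apply: (@is_derive_eq _ _ _ _ _ _ _ _ h).
  by rewrite !fctE /GRing.scale /= mulr0 add0r addr0 mulr1.
rewrite -[RHS](@derive_val _ _ _ _ _ _ _ hl); apply: near_eq_derive.
near=> s; have s1 : 0 < s + 1.
  rewrite -ltrBlDr sub0r; near: s; apply: lt_nbhsr.
  by rewrite ltrN10.
have := hF i p (s + 1) Dp s1; rewrite -/f => <-; congr f.
rewrite /gamma [p in LHS]surjective_pairing; congr pair.
  by rewrite /= scaler0 add0r.
by rewrite /= scalerDl scale1r.
Unshelve. all: by end_near. Qed.
End ChartInvariance.

(** * Leibniz rule for scalar multiples of vector functions *)

Section Scale.
Context (R : realType) (n : nat) (U : normedModType R).
Variables (c : U -> R) (w : U -> 'rV[R]_n) (p : U).
Hypotheses (dc : differentiable c p) (dw : differentiable w p).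

Lemma differentiable_scale : differentiable (fun q => c q *: w q) p.
Proof.
apply: differentiable_coordP => j.
have -> : (fun q => (c q *: w q) 0 j) = c * (fun q => w q 0 j).
  by apply/funext => q; rewrite mxE.
apply: differentiableM => //.
exact: (linear_comp_differentiable (@coord_linear R n j) (@vcoord_continuous R n j)).
Qed.

Lemma derive_scale v :
  'D_v (fun q => c q *: w q) p = 'D_v c p *: w p + c p *: 'D_v w p.
Proof.
apply/rowP => j; have lj := @coord_linear R n j; have cj := @vcoord_continuous R n j.
rewrite -[LHS](derive_linear_comp lj cj _ differentiable_scale) !mxE.
rewrite -(derive_linear_comp lj cj _ dw).
have -> : (fun q => (c q *: w q) 0 j) = c * (fun q => w q 0 j).
  by apply/funext => q; rewrite mxE.
rewrite deriveM; [|exact: diff_derivable|].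
  by rewrite addrC; congr (_ + _); rewrite /GRing.scale /= mulrC.
exact/diff_derivable/(linear_comp_differentiable lj cj).
Qed.
End Scale.

Lemma ndiff_half_sqr (R : realType) (U : normedModType R) k (O : set U)
    (F : U -> R) : open O -> ndiff k O F -> ndiff k O (fun q => F q ^+ 2 / 2).
Proof.
move=> oO nF; apply: (ndiffM oO _ (ndiff_cst k O (2^-1 : R))).
by apply: ndiff_eq oO _ (ndiffM oO nF nF) => q _; rewrite expr2.
Qed.

(** * The relation between the two sprays in a chart *)

Section ChartSpray.
Context (R : realType) (n : nat).
Local Notation V := 'rV[R]_n.
Variables (O O' : set (V * V)) (F Fh : V * V -> R) (G Gh : V * V -> V * V)
  (phi : V * V -> V).

(** Written so that [half_sqr (floc F i)] is convertible with [floc (energy F) i]. *)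
Definition half_sqr (F : V * V -> R) q := F q ^+ 2 / 2.
Local Notation E := (half_sqr F).
Local Notation Eh := (half_sqr Fh).
Local Notation P := (Phi_of E phi).

Hypotheses (oO : open O) (OO' : O `<=` O').
Hypotheses (nF : ndiff 3 O F) (nFh : ndiff 3 O Fh).
Hypotheses (nG : ndiff 3 O G) (nphi : ndiff 3 O phi).
Hypothesis F_homo : forall p, O p -> 'D_(gamma p.2) F p = F p.
Hypothesis Fh_homo : forall p, O p -> 'D_(gamma p.2) Fh p = Fh p.
Hypothesis G1 : forall p, O p -> vJ (G p) = liouville p.
Hypothesis Gh1 : forall p, O p -> vJ (Gh p) = liouville p.
Hypothesis Gbr : forall p, O p -> bracket (@liouville R n) G p = G p.
Hypothesis GE : forall p zeta, O p -> ddJ E p (G p) zeta = - 'D_zeta E p.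
Hypothesis GhE : forall p zeta, O p -> ddJ Eh p (Gh p) zeta = - 'D_zeta Eh p.
Hypothesis PF : forall p, O p -> P p < F p.
Hypothesis FhE : forall p, O p -> Fh p = F p ^+ 2 / (F p - P p).
Hypothesis rankEh : forall p, O p -> max_rank (ddJ Eh p).
Hypothesis bh : forall a,
  berwald_h O G (fun=> a) phi (fun=> - a).
Hypothesis bv : forall a,
  berwald_v O G (fun=> a) phi (fun=> 0).
Hypothesis cv : forall a,
  cartan_v O' E G (fun=> a) phi (fun=> 0).

Let g q := (G q).2.
Let gh q := (Gh q).2.

Let nE : ndiff 3 O E. Proof. exact: ndiff_half_sqr. Qed.
Let ng : ndiff 2 O g. Proof. exact: (ndiffS (ndiff_snd_spray oO nG)). Qed.
Let nphi2 : ndiff 2 O phi. Proof. exact: ndiffS. Qed.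

Lemma half_sqr_homo p : O p -> 'D_(gamma p.2) E p = 2 * E p.
Proof.
move=> Op; apply: etrans (derive_half_sqr nF _ Op) _; rewrite F_homo// /half_sqr.
by field.
Qed.

Let half_sqr_hat_homo p : O p -> 'D_(gamma p.2) Eh p = 2 * Eh p.
Proof.
move=> Op; apply: etrans (derive_half_sqr nFh _ Op) _; rewrite Fh_homo// /half_sqr.
by field.
Qed.

Let EL p a : O p -> 'D_(spray_of g p) ('D_(gamma a) E) p = 'D_(a, 0) E p.
Proof.
move=> Op; rewrite -(sprayE G1 Op).
apply: (spray_euler_lagrange oO G1 a Op (ndiffS nE) half_sqr_homo).
by move=> zeta; exact: GE.
Qed.

Let Econst p : O p -> 'D_(spray_of g p) E p = 0.
Proof.
move=> Op; rewrite -(sprayE G1 Op); apply: spray_energy_const => zeta.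
exact: GE.
Qed.

Let ghomo p : O p -> 'D_(gamma p.2) g p = 2 *: g p.
Proof. by move=> Op; exact: (spray_homo oO nG G1 Op (Gbr Op)). Qed.

Lemma phi_vertical p a : O p -> 'D_(gamma a) phi p = 0.
Proof. by move=> Op; exact: (berwald_v_vert oO nG G1 nphi Op (bv a)). Qed.

Let phi_horizontal p a : O p ->
  'D_(hlift g a p) phi p = 2^-1 *: 'D_(gamma (phi p)) ('D_(gamma a) g) p - a.
Proof. by move=> Op; exact: (berwald_h_hor oO nG G1 nphi Op (bh a)). Qed.

Let phi_cartan p u z : O p ->
  'D_(gamma u) (fun q => 'D_(gamma (phi q)) ('D_(gamma z) E) q) p = 0.
Proof. by move=> Op; exact: (cartan_v_vert oO nG G1 z OO' Op (bv u) (cv u)). Qed.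

Lemma Phi_half_sqr_ndiff : ndiff 2 O P.
Proof. exact: Phi_ndiff oO nE nphi2. Qed.

Lemma vert_Phi_half_sqr p z : O p ->
  'D_(gamma z) P p = 'D_(gamma (phi p)) ('D_(gamma z) E) p.
Proof. exact: (vert_Phi oO nE nphi2 phi_vertical z). Qed.

(** Symmetry of the Hessian and Euler's theorem; this identifies [Phi_of] with g(phi, eta). *)
Lemma Phi_etabar p : O p ->
  'D_(gamma (phi p)) ('D_(gamma p.2) E) p = P p.
Proof.
move=> Op; rewrite (derive_swap_ndiff _ _ oO Op (ndiffS nE)).
exact: (euler_vert oO nE half_sqr_homo (phi p) Op).
Qed.

Let F0 p : O p -> F p != 0.
Proof.
(* Where F = 0, also Phi = D_phi (F^2 / 2) = 0, which contradicts Phi < F. *)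
move=> Op; apply/eqP => Fp0; have := PF Op; rewrite /Phi_of Fp0.
have -> : 'D_(gamma (phi p)) E p = 0.
  by apply: etrans (derive_half_sqr nF _ Op) _; rewrite Fp0 mul0r.
by rewrite ltxx.
Qed.

Let s0 p : O p -> F p - P p != 0.
Proof. by move=> Op; rewrite subr_eq0 gt_eqF// PF. Qed.

Let EhE p : O p -> Eh p = matsumoto_energy F P p.
Proof. by move=> Op; rewrite /half_sqr /matsumoto_energy FhE. Qed.

Let ddJ_hat p : O p -> ddJ (matsumoto_energy F P) p = ddJ Eh p.
Proof.
have dJE q xi : O q -> dJ (matsumoto_energy F P) q xi = dJ Eh q xi.
  by move=> Oq; apply: derive_eq_on oO Oq _ => r Or; rewrite EhE.
move=> Op; apply/funext => xi; apply/funext => zeta.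
have H u v : derive (dJ (matsumoto_energy F P) ^~ u) p v = derive (dJ Eh ^~ u) p v.
  by apply: derive_eq_on oO Op _ => q; exact: dJE.
exact: (f_equal2 (fun x y => x - y) (H zeta xi) (H xi zeta)).
Qed.

(** P is available to order 2 here, so the third order comes from Fhat, whose energy is the same
    function on O. *)
Let nEh : ndiff 3 O (matsumoto_energy F P).
Proof. exact: ndiff_eq oO EhE (ndiff_half_sqr oO nFh). Qed.

Let ELh p a : O p -> 'D_(spray_of gh p) ('D_(gamma a) (matsumoto_energy F P)) p
  = 'D_(a, 0) (matsumoto_energy F P) p.
Proof.
move=> Op; rewrite -(sprayE Gh1 Op).
apply: (spray_euler_lagrange oO Gh1 a Op (ndiffS nEh)).
  move=> q Oq; rewrite -(EhE Oq) -(half_sqr_hat_homo Oq).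
  by apply: derive_eq_on oO Oq _ => r Or; rewrite EhE.
move=> zeta; rewrite (ddJ_hat Op) (GhE _ Op); congr (- _).
by apply: derive_eq_on oO Op _ => r Or; rewrite EhE.
Qed.

Lemma chart_spray (f1 f2 : R) p :
  O p ->
  let K := F p * (1 + 2 * 'D_(gamma (phi p)) P p) - 3 * P p in
  K != 0 ->
  f1 = F p * (4 * P p - F p) / K -> f2 = 2 * F p ^+ 3 / K ->
  gh p = g p - f1 *: p.2 + f2 *: phi p.
Proof.
apply: (matsumoto_spray oO nF Phi_half_sqr_ndiff F0 s0 EL Econst F_homo _ _ _ _ _ _
  (ndiffS nEh) _ ELh).
- by [].
- by move=> q Oq; exact: (spray_Phi oO nE ng nphi2 EL Econst ghomo half_sqr_homo
    phi_horizontal Oq).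
- by move=> q a Oq; exact: (euler_lagrange_Phi oO nE ng nphi2 EL Econst ghomo
    half_sqr_homo phi_horizontal a Oq).
- exact: vert_Phi_half_sqr.
- by move=> q u z Oq; exact: (vert2_Phi oO nE nphi2 phi_vertical phi_cartan u z Oq).
- by move=> q Oq; exact: (Phi_homo oO nE nphi2 half_sqr_homo phi_vertical Oq).
- by move=> q Oq; rewrite (ddJ_hat Oq); exact: rankEh.
Qed.
End ChartSpray.

(** * From the sprays to the connections *)

Section ConnectionChange.
Context (R : realType) (n : nat).
Local Notation V := 'rV[R]_n.
Variables (O : set (V * V)) (G Gh : V * V -> V * V) (phi : V * V -> V)
  (f1 f2 : V * V -> R).
Hypotheses (oO : open O) (nG : ndiff 3 O G) (nGh : ndiff 3 O Gh).
Hypothesis G1 : forall p, O p -> vJ (G p) = liouville p.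
Hypothesis Gh1 : forall p, O p -> vJ (Gh p) = liouville p.
Hypothesis dphi : forall p, O p -> differentiable phi p.
Hypothesis phi_vert : forall p a, O p -> 'D_(gamma a) phi p = 0.
Hypothesis df1 : forall p, O p -> differentiable f1 p.
Hypothesis df2 : forall p, O p -> differentiable f2 p.
Hypothesis GhG : forall p, O p ->
  (Gh p).2 = (G p).2 - f1 p *: p.2 + f2 p *: phi p.

(** The Leibniz rule; phi contributes no derivative because it is constant along the fibres. The
    terms are those of - f1 J - d_J f1 (x) C + d_J f2 (x) gamma phi on a vector over a. *)
Lemma derive_spray_change p a : O p ->
  'D_(gamma a) (fun q => (Gh q).2) p = 'D_(gamma a) (fun q => (G q).2) p
   - f1 p *: a - 'D_(gamma a) f1 p *: p.2 + 'D_(gamma a) f2 p *: phi p.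
Proof.
move=> Op; rewrite (derive_eq_on (gamma a) oO Op GhG).
have dg := (ndiff_snd_spray oO nG).1 p Op.
have d1 := differentiable_scale (df1 Op) (differentiable_psnd p).
have d2 := differentiable_scale (df2 Op) (dphi Op).
have dB := is_deriveB (diff_is_derive (gamma a) dg) (diff_is_derive (gamma a) d1).
have dD := is_deriveD dB (diff_is_derive (gamma a) d2).
apply: etrans (@derive_val _ _ _ _ _ _ _ dD) _.
rewrite (derive_scale (df1 Op) (differentiable_psnd p)).
rewrite (derive_scale (df2 Op) (dphi Op)) derive_snd (phi_vert _ Op).
by rewrite scaler0 addr0 [_ *: p.2 + _]addrC opprD addrA.
Qed.

Lemma barthel_change (X : V * V -> V * V) p : O p -> differentiable X p ->
  barthel Gh X p = barthel G X p - f1 p *: vJ (X p)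
    - dJ f1 p (X p) *: gamma p.2 + dJ f2 p (X p) *: gamma (phi p).
Proof.
move=> Op dX; rewrite (barthelE oO nGh Gh1 Op dX) (barthelE oO nG G1 Op dX).
rewrite (derive_spray_change _ Op) /dJ /vJ /rho /gamma; congr pair => /=.
  by rewrite !scaler0 !subr0 addr0.
by rewrite addrC !addrA [- _ + _]addrC.
Qed.

(** J beta W = gamma W, so d_J f at beta W is the derivative of f along gamma W, as it appears in
    the halved derivative of the spray. *)
Lemma beta_change (W : V * V -> V) p : O p ->
  beta Gh W p = beta G W p - 2^-1 *: (f1 p *: gamma (W p)
    + dJ f1 p (beta G W p) *: gamma p.2 - dJ f2 p (beta G W p) *: gamma (phi p)).
Proof.
move=> Op; rewrite (betaE oO nGh Gh1 _ Op) (betaE oO nG G1 _ Op) /hlift.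
rewrite (derive_spray_change _ Op) /dJ /vJ /rho /gamma; congr pair => /=.
  by rewrite !scaler0 addr0 subr0 scaler0 subr0.
by rewrite -scalerBr; congr (_ *: _); rewrite !opprD opprK !addrA.
Qed.
End ConnectionChange.

(** * Assembly over the charts of the manifold *)

Theorem proposition3p3 (R : realType) (n : nat) (M : smoothManifold R n)
    (F : TM M -> R) (G : vfield M) (phi : pifield M)
    (Fhat : TM M -> R) (Ghat : vfield M) :
  finsler F ->
  geodesic_spray slit F G ->
  concurrent F G phi ->
  let Phi := fun u => metric_at F (phi u) (etabar u) in
  let p2 := fun u => metric_at F (phi u) (phi u) in
  let D := [set u | Phi u < F u] in
  (forall u, D u -> Fhat u = F u ^+ 2 / (F u - Phi u)) ->
  conic_pseudo_finsler D Fhat ->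
  geodesic_spray D Fhat Ghat ->
  (forall u, D u -> F u * (1 + 2 * p2 u) - 3 * Phi u != 0) ->
  let f1 := fun u =>
    F u * (4 * Phi u - F u) / (F u * (1 + 2 * p2 u) - 3 * Phi u) in
  let f2 := fun u =>
    2 * F u ^+ 3 / (F u * (1 + 2 * p2 u) - 3 * Phi u) in
  (forall i (X : 'rV[R]_n * 'rV[R]_n -> 'rV[R]_n * 'rV[R]_n),
     smooth_on (loc D i) X -> forall p, loc D i p ->
     barthel (vloc Ghat i) X p =
       barthel (vloc G i) X p
       - floc f1 i p *: vJ (X p)
       - dJ (floc f1 i) p (X p) *: gamma (piloc etabar i p)
       + dJ (floc f2 i) p (X p) *: gamma (piloc phi i p)) /\
  (forall i (W : 'rV[R]_n * 'rV[R]_n -> 'rV[R]_n),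
     smooth_on (loc D i) W -> forall p, loc D i p ->
     beta (vloc Ghat i) W p =
       beta (vloc G i) W p
       - 2^-1 *: (floc f1 i p *: gamma (W p)
                  + dJ (floc f1 i) p (beta (vloc G i) W p)
                    *: gamma (piloc etabar i p)
                  - dJ (floc f2 i) p (beta (vloc G i) W p)
                    *: gamma (piloc phi i p))).
Proof.
move=> finF spG conc Phi p2 D FhatE conF spGhat K0 f1 f2.
have [_ sF _ F_homo _] := finF.
have [cD _ sFh Fh_homo rankFh] := conF.
have [sphi _ concW] := conc.
(* Both formulas follow from the same data in chart i: regularity, JG = C, fibrewise constancy of
   phi, and the relation between the sprays. *)
have chart i : [/\ open (loc D i), ndiff 3 (loc D i) (vloc G i),
    ndiff 3 (loc D i) (vloc Ghat i),
    (forall p, loc D i p -> vJ (vloc G i p) = liouville p) &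
    (forall p, loc D i p -> vJ (vloc Ghat i p) = liouville p)] /\
  [/\ (forall p, loc D i p -> differentiable (piloc phi i) p),
    (forall p a, loc D i p -> 'D_(gamma a) (piloc phi i) p = 0),
    (forall p, loc D i p -> differentiable (floc f1 i) p),
    (forall p, loc D i p -> differentiable (floc f2 i) p) &
    (forall p, loc D i p -> (vloc Ghat i p).2 =
      (vloc G i p).2 - floc f1 i p *: p.2 + floc f2 i p *: piloc phi i p)].
  set O := loc D i; set O' := loc slit i.
  have oO : open O by exact: conic_open.
  have OO' : O `<=` O' by move=> p [pi Dp]; split=> //; exact: (conic_slit cD).
  have [sG G1 Gbr GE] := spG i; have [sGh Gh1 _ GhE] := spGhat i.
  have nF : ndiff 3 O (floc F i).
    by apply: ndiff_sub OO' _; apply: smooth_on_ndiff; exact: sF.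
  have nFh : ndiff 3 O (floc Fhat i) by apply: smooth_on_ndiff; exact: sFh.
  have nG : ndiff 3 O (vloc G i).
    by apply: ndiff_sub OO' _; exact: smooth_on_ndiff.
  have nGh : ndiff 3 O (vloc Ghat i) by exact: smooth_on_ndiff.
  have nphi : ndiff 3 O (piloc phi i).
    by apply: ndiff_sub OO' _; apply: smooth_on_ndiff; exact: sphi.
  have hF p : O p -> 'D_(gamma p.2) (floc F i) p = floc F i p.
    move=> Op; apply: (derive_homogeneous1 F_homo); first by case: Op.
    exact: nF.1.
  have hFh p : O p -> 'D_(gamma p.2) (floc Fhat i) p = floc Fhat i p.
    move=> Op; apply: (derive_homogeneous1 Fh_homo Op); exact: nFh.1.
  (* Concurrency is applied to constant fields, one for each direction a. *)
  have c_cst a := concW i (fun=> a) (@smooth_on_cst _ _ _ _ a).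
  have bh a : berwald_h O (vloc G i) (fun=> a) (piloc phi i) (fun=> - a).
    by have [_ + _ _] := c_cst a => H p /OO'; exact: H.
  have bv a : berwald_v O (vloc G i) (fun=> a) (piloc phi i) (fun=> 0).
    by have [_ _ _] := c_cst a => H p /OO'; exact: H.
  have cv a : cartan_v O' (half_sqr (floc F i)) (vloc G i) (fun=> a)
      (piloc phi i) (fun=> 0).
    by have [_ _ + _] := c_cst a.
  have G1' p : O p -> vJ (vloc G i p) = liouville p by move=> /OO'; exact: G1.
  pose E := half_sqr (floc F i); pose P := Phi_of E (piloc phi i).
  have phiv p a : O p -> 'D_(gamma a) (piloc phi i) p = 0.
    exact: phi_vertical oO nG nphi G1' bv p a.
  (* The global Phi is computed in a chosen chart at each point; chart invariance of the metric
     brings it to chart i. *)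
  have PE p : O p -> floc Phi i p = P p.
    move=> Op; rewrite metric_at_loc; last by case: Op.
    rewrite etabarE; last by case: Op.
    exact: (Phi_etabar (piloc phi i) oO nF hF Op).
  (* g(phi, phi) is the Hessian of E on phi, hence the derivative of Phi along phi. *)
  have p2E p : O p -> floc p2 i p = 'D_(gamma (piloc phi i p)) P p.
    move=> Op; rewrite metric_at_loc; last by case: Op.
    exact/esym/(vert_Phi_half_sqr oO nF nG nphi G1' bv _ Op).
  have PF p : O p -> P p < floc F i p by move=> Op; rewrite -PE//; case: Op.
  have FhE p : O p -> floc Fhat i p = floc F i p ^+ 2 / (floc F i p - P p).
    by move=> Op; rewrite -PE//; apply: FhatE; case: Op.
  pose K p := floc F i p * (1 + 2 * 'D_(gamma (piloc phi i p)) P p) - 3 * P p.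
  have K0' p : O p -> K p != 0.
    by move=> Op; rewrite /K -PE// -p2E//; apply: K0; case: Op.
  have f1E p : O p -> floc f1 i p =
      floc F i p * (4 * P p - floc F i p) / K p.
    by move=> Op; rewrite /K -PE// -p2E.
  have f2E p : O p -> floc f2 i p = 2 * floc F i p ^+ 3 / K p.
    by move=> Op; rewrite /K -PE// -p2E.
  have nP : ndiff 2 O P by exact: Phi_half_sqr_ndiff oO nF nphi.
  have dF p : O p -> differentiable (floc F i) p by exact: nF.1.
  have dP p : O p -> differentiable P p by exact: nP.1.
  have dK p : O p -> differentiable K p.
    move=> Op; apply: differentiableB; last first.
      exact: differentiableM (differentiable_cst (3 : R) p) (dP p Op).
    apply: differentiableM (dF p Op) _.
    apply: differentiableD (differentiable_cst (1 : R) p) _.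
    apply: differentiableM (differentiable_cst (2 : R) p) _.
    apply: (ndiff_dir oO nP (w := fun q => gamma (piloc phi i q)) _).1 => //.
    exact: ndiff_gamma (ndiffS (ndiffS nphi)).
  have dKV p : O p -> differentiable (fun q => (K q)^-1) p.
    by move=> Op; exact: differentiableV (dK p Op) (K0' p Op).
  split; split=> //.
  - exact: nphi.1.
  - move=> p Op; apply: (differentiable_eq_on oO Op (fun q Oq => esym (f1E q Oq))).
    apply: differentiableM (dKV p Op); apply: differentiableM (dF p Op) _.
    apply: differentiableB (dF p Op).
    exact: differentiableM (differentiable_cst (4 : R) p) (dP p Op).
  - move=> p Op; apply: (differentiable_eq_on oO Op (fun q Oq => esym (f2E q Oq))).
    apply: differentiableM (dKV p Op).
    apply: differentiableM (differentiable_cst (2 : R) p) _.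
    have -> : (fun q => floc F i q ^+ 3) = floc F i * (floc F i * floc F i).
      by apply/funext => q; rewrite exprS expr2.
    exact: differentiableM (dF p Op) (differentiableM (dF p Op) (dF p Op)).
  - move=> p Op; exact: (chart_spray oO OO' nF nFh nG nphi hF hFh G1' Gh1
      (fun q Oq => Gbr q (OO' q Oq)) (fun q z Oq => GE q z (OO' q Oq)) GhE PF
      FhE (rankFh i) bh bv cv Op (K0' p Op) (f1E p Op) (f2E p Op)).
split=> i.
  move=> X sX p Op; have [[oO nG nGh G1 Gh1] [dphi phiv df1 df2 GhG]] := chart i.
  rewrite etabarE; last by case: Op.
  exact: (barthel_change oO nG nGh G1 Gh1 dphi phiv df1 df2 GhG Op (sX [::] p Op)).
move=> W sW p Op; have [[oO nG nGh G1 Gh1] [dphi phiv df1 df2 GhG]] := chart i.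
rewrite etabarE; last by case: Op.
exact: (beta_change oO nG nGh G1 Gh1 dphi phiv df1 df2 GhG W Op).
Qed.
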